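(* Let $H$ be a Hopf algebra in $\mathcal C$, $A$ an algebra in $\mathcal C$, and let $(\varphi_A,\omega)$, with $\varphi_A:H\otimes A\to A$ and $\omega:H\otimes H\to A$, be a twisted partial action of $H$ on $A$ satisfying the partial cocycle condition $$\mu_{A}\circ (A\otimes \omega)\circ (\psi_{H}^{A}\otimes H)\circ (H\otimes \sigma_{H}^{A})=\mu_{A}\circ (A\otimes \omega)\circ (\sigma_{H}^{A}\otimes H),$$ where $\psi_{H}^{A}=(\varphi_{A}\otimes H)\circ (H\otimes c_{H,A})\circ (\delta_{H}\otimes A)$ and $\sigma_{H}^{A}=(\omega\otimes \mu_{H})\circ \delta_{H\otimes H}$. Then, with $$\mu_{A\otimes H} = (\mu_A\otimes H)\circ (\mu_A\otimes \sigma_{H}^{A})\circ (A\otimes \psi_{H}^{A}\otimes H),$$ the pair $(A\otimes H,\mu_{A\otimes H})$ is a weak crossed product (the one induced by the quadruple $(A,H,\psi_H^A,\sigma_H^A)$), and the induced product $\mu_{A\times H}=p_{A\otimes H}\circ\mu_{A\otimes H}\circ(i_{A\otimes H}\otimes i_{A\otimes H})$ on $A\times H$ is associative. Moreover, when $\mathcal C$ is the category of $k$-modules over a commutative unital ring $k$, $\mu_{A\otimes H}$ is the partial crossed product multiplication $(a\otimes h)(b\otimes l)=\sum a(h_{(1)}\cdot b)\,\omega(h_{(2)}\otimes l_{(1)})\otimes h_{(3)}l_{(2)}$, where $h\cdot b=\varphi_A(h\otimes b)$.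
   Context: $\mathcal C$ is a strict braided monoidal category with tensor product $\otimes$, base object $K$ and braiding $c$, in which every idempotent splits. For an object $X$ and a morphism $f$, $X\otimes f$ means $id_X\otimes f$ and $f\otimes X$ means $f\otimes id_X$. Algebras $(A,\eta_A,\mu_A)$ (unital, associative), coalgebras $(D,\varepsilon_D,\delta_D)$, bialgebras and Hopf algebras are taken in $\mathcal C$. $\delta_{H\otimes H}=(H\otimes c_{H,H}\otimes H)\circ(\delta_H\otimes\delta_H)$. Twisted partial action: a pair $(\varphi_A:H\otimes A\to A,\ \omega:H\otimes H\to A)$ such that (i) $\varphi_{A}\circ (\eta_{H}\otimes A)=id_{A}$; (ii) $\varphi_{A}\circ (H\otimes \mu_{A})=\mu_{A}\circ (\varphi_{A}\otimes \varphi_{A})\circ (H\otimes c_{H,A}\otimes A)\circ (\delta_{H}\otimes A\otimes A)$; (iii) $\mu_{A}\circ (A\otimes \omega)\circ (\psi_{H}^{A}\otimes H)\circ (H\otimes \psi_{H}^{A})=\mu_{A}\circ (A\otimes \varphi_{A})\circ (\sigma_{H}^{A}\otimes A)$; (iv) $\omega=\mu_{A}\circ (A\otimes \varphi_{A})\circ (\sigma_{H}^{A}\otimes \eta_{A})$; with $\psi_H^A,\sigma_H^A$ given by the formulas in the claim. Weak crossed product: let $A$ be an algebra, $V$ an object, $\psi_V^A:V\otimes A\to A\otimes V$ and $\sigma_V^A:V\otimes V\to A\otimes V$ morphisms with $(\mu_A\otimes V)\circ (A\otimes \psi_{V}^{A})\circ(\psi_{V}^{A}\otimes A) = \psi_{V}^{A}\circ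 (V\otimes \mu_A)$. Then $\nabla_{A\otimes V} = (\mu_A\otimes V)\circ(A\otimes\psi_{V}^{A})\circ (A\otimes V\otimes \eta_A)$ is idempotent; $A\times V$, $i_{A\otimes V}:A\times V\to A\otimes V$, $p_{A\otimes V}:A\otimes V\to A\times V$ denote the object, injection and projection of its splitting ($\nabla_{A\otimes V}=i_{A\otimes V}\circ p_{A\otimes V}$, $p_{A\otimes V}\circ i_{A\otimes V}=id$). For all quadruples $(A,V,\psi_V^A,\sigma_V^A)$ one requires $\nabla_{A\otimes V}\circ\sigma_V^A=\sigma_V^A$. The twisted condition is $(\mu_A\otimes V)\circ (A\otimes \psi_{V}^{A})\circ(\sigma_{V}^{A}\otimes A) = (\mu_A\otimes V)\circ (A\otimes\sigma_{V}^{A})\circ (\psi_{V}^{A}\otimes V)\circ (V\otimes\psi_{V}^{A})$, and the cocycle condition is $(\mu_A\otimes V)\circ (A\otimes \sigma_{V}^{A}) \circ(\sigma_{V}^{A}\otimes V) = (\mu_A\otimes V)\circ (A\otimes\sigma_{V}^{A})\circ (\psi_{V}^{A}\otimes V)\circ(V\otimes\sigma_{V}^{A})$. If the twisted and cocycle conditions hold, $(A\otimes V,\mu_{A\otimes V})$ with $\mu_{A\otimes V}=(\mu_A\otimes V)\circ (\mu_A\otimes\sigma_{V}^{A})\circ (A\otimes \psi_{V}^{A}\otimes V)$ is called a weak crossed product. *)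

(* Defs.v *)
From HB Require Import structures.
From mathcomp Require Import all_boot all_order all_algebra generic_quotient boolp.

Set Implicit Arguments.
Unset Strict Implicit.
Unset Printing Implicit Defensive.

Import GRing.Theory.

Declare Scope cat_scope.
Delimit Scope cat_scope with C.

Reserved Notation "g ∘ f" (at level 40, left associativity).
Reserved Notation "X ⊗ Y" (at level 37, left associativity).
Reserved Notation "f ⊠ g" (at level 37, left associativity).
Reserved Notation "X ◁ f" (at level 37, left associativity).
Reserved Notation "f ▷ X" (at level 37, left associativity).

Record category := Category {
  Obj :> Type;
  Mor : Obj -> Obj -> Type;
  idm : forall X, Mor X X;
  comp : forall X Y Z, Mor Y Z -> Mor X Y -> Mor X Z;
  comp_idl : forall X Y (f : Mor X Y), comp (idm Y) f = f;
  comp_idr : forall X Y (f : Mor X Y), comp f (idm X) = f;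
  compA : forall X Y Z W (h : Mor Z W) (g : Mor Y Z) (f : Mor X Y),
    comp h (comp g f) = comp (comp h g) f
}.
Arguments idm {c} X.
Arguments comp {c X Y Z} g f.

Notation "g ∘ f" := (comp g f) : cat_scope.
Local Open Scope cat_scope.

(* Monoidal categories are not required to be strict: the associativity and   *)
(* unit constraints are kept explicit.  A strict monoidal category is the     *)
(* case in which they are identities, and the (non-strict) category of        *)
(* k-modules is an instance as it stands.                                     *)
Record monoidalCat := MonoidalCat {
  mcat :> category;
  tens : mcat -> mcat -> mcat;
  tensm : forall (X Y Z W : mcat),
    Mor X Y -> Mor Z W -> Mor (tens X Z) (tens Y W);
  munit : mcat;
  assoc : forall X Y Z : mcat,
    Mor (tens (tens X Y) Z) (tens X (tens Y Z));
  assocV : forall X Y Z : mcat,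
    Mor (tens X (tens Y Z)) (tens (tens X Y) Z);
  lunit : forall X : mcat, Mor (tens munit X) X;
  lunitV : forall X : mcat, Mor X (tens munit X);
  runit : forall X : mcat, Mor (tens X munit) X;
  runitV : forall X : mcat, Mor X (tens X munit);
  tensm_id : forall X Y : mcat, tensm (idm X) (idm Y) = idm (tens X Y);
  tensm_comp : forall (X Y Z X' Y' Z' : mcat) (g : Mor Y Z) (f : Mor X Y)
      (g' : Mor Y' Z') (f' : Mor X' Y'),
    tensm (g ∘ f) (g' ∘ f') = tensm g g' ∘ tensm f f';
  assocK : forall X Y Z, assocV X Y Z ∘ assoc X Y Z = idm _;
  assocVK : forall X Y Z, assoc X Y Z ∘ assocV X Y Z = idm _;
  lunitK : forall X, lunitV X ∘ lunit X = idm _;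
  lunitVK : forall X, lunit X ∘ lunitV X = idm _;
  runitK : forall X, runitV X ∘ runit X = idm _;
  runitVK : forall X, runit X ∘ runitV X = idm _;
  assoc_nat : forall (X Y Z X' Y' Z' : mcat)
      (f : Mor X X') (g : Mor Y Y') (h : Mor Z Z'),
    assoc X' Y' Z' ∘ tensm (tensm f g) h = tensm f (tensm g h) ∘ assoc X Y Z;
  lunit_nat : forall (X Y : mcat) (f : Mor X Y),
    lunit Y ∘ tensm (idm munit) f = f ∘ lunit X;
  runit_nat : forall (X Y : mcat) (f : Mor X Y),
    runit Y ∘ tensm f (idm munit) = f ∘ runit X;
  pentagon : forall W X Y Z : mcat,
    tensm (idm W) (assoc X Y Z) ∘ assoc W (tens X Y) Z
      ∘ tensm (assoc W X Y) (idm Z)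
    = assoc W X (tens Y Z) ∘ assoc (tens W X) Y Z;
  triangle : forall X Y : mcat,
    tensm (idm X) (lunit Y) ∘ assoc X munit Y = tensm (runit X) (idm Y)
}.
Arguments tens {m} X Y.
Arguments tensm {m X Y Z W} f g.
Arguments munit {m}.
Arguments assoc {m X Y Z}.
Arguments assocV {m X Y Z}.
Arguments lunit {m X}.
Arguments lunitV {m X}.
Arguments runit {m X}.
Arguments runitV {m X}.

Notation "X ⊗ Y" := (tens X Y) : cat_scope.
Notation "f ⊠ g" := (tensm f g) : cat_scope.
Notation "X ◁ f" := (tensm (idm X) f) : cat_scope.
Notation "f ▷ X" := (tensm f (idm X)) : cat_scope.

Record braidedCat := BraidedCat {
  bcat :> monoidalCat;
  braid : forall X Y : bcat, Mor (X ⊗ Y) (Y ⊗ X);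
  braidV : forall X Y : bcat, Mor (Y ⊗ X) (X ⊗ Y);
  braidK : forall X Y, braidV X Y ∘ braid X Y = idm _;
  braidVK : forall X Y, braid X Y ∘ braidV X Y = idm _;
  braid_nat : forall (X Y X' Y' : bcat) (f : Mor X X') (g : Mor Y Y'),
    braid X' Y' ∘ (f ⊠ g) = (g ⊠ f) ∘ braid X Y;
  hexagon1 : forall X Y Z : bcat,
    assoc ∘ braid X (Y ⊗ Z) ∘ assoc
    = (Y ◁ braid X Z) ∘ assoc ∘ (braid X Y ▷ Z);
  hexagon2 : forall X Y Z : bcat,
    assocV ∘ braid (X ⊗ Y) Z ∘ assocV
    = (braid X Z ▷ Y) ∘ assocV ∘ (X ◁ braid Y Z)
}.
Arguments braid {b} X Y.
Arguments braidV {b} X Y.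

Record splitting (C : category) (X : C) (e : Mor X X) := Splitting {
  spl_obj : C;
  spl_inj : Mor spl_obj X;
  spl_proj : Mor X spl_obj;
  spl_injproj : spl_inj ∘ spl_proj = e;
  spl_projinj : spl_proj ∘ spl_inj = idm spl_obj
}.

Definition idempotent (C : category) (X : C) (e : Mor X X) := e ∘ e = e.

Definition idempotents_split (C : category) :=
  forall (X : C) (e : Mor X X), idempotent e -> inhabited (splitting e).

Section Middle.
Variable C : monoidalCat.

(* X ⊗ f ⊗ W, for f acting on the two middle factors of four. *)
Definition mid (X W Y Z Y' Z' : C) (f : Mor (Y ⊗ Z) (Y' ⊗ Z')) :
    Mor ((X ⊗ Y) ⊗ (Z ⊗ W)) ((X ⊗ Y') ⊗ (Z' ⊗ W)) :=
  assocV ∘ (X ◁ (assoc ∘ (f ▷ W) ∘ assocV)) ∘ assoc.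
End Middle.
Arguments mid {C} X W {Y Z Y' Z'} f.

Definition associative_mul (C : monoidalCat) (X : C) (m : Mor (X ⊗ X) X) :=
  m ∘ (m ▷ X) = m ∘ (X ◁ m) ∘ assoc.

Record algebra (C : monoidalCat) := Algebra {
  alg_obj :> C;
  unit_ : Mor munit alg_obj;
  mul : Mor (alg_obj ⊗ alg_obj) alg_obj;
  mulA : associative_mul mul;
  mul_unitl : mul ∘ (unit_ ▷ alg_obj) = lunit;
  mul_unitr : mul ∘ (alg_obj ◁ unit_) = runit
}.
Arguments unit_ {C} a.
Arguments mul {C} a.

Record coalgebra_on (C : monoidalCat) (D : C) := CoalgebraOn {
  counit_on : Mor D munit;
  comul_on : Mor D (D ⊗ D);
  comulA : assoc ∘ (comul_on ▷ D) ∘ comul_on = (D ◁ comul_on) ∘ comul_on;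
  counitl : lunit ∘ (counit_on ▷ D) ∘ comul_on = idm D;
  counitr : runit ∘ (D ◁ counit_on) ∘ comul_on = idm D
}.

Section Braided.
Variable C : braidedCat.

Definition comul2 (D : C) (d : Mor D (D ⊗ D)) :
    Mor (D ⊗ D) ((D ⊗ D) ⊗ (D ⊗ D)) :=
  mid D D (braid D D) ∘ (d ⊠ d).

Record bialgebra := Bialgebra {
  bialg_alg :> algebra C;
  bialg_coalg : coalgebra_on (alg_obj bialg_alg);
  comul_mul : comul_on bialg_coalg ∘ mul bialg_alg
    = (mul bialg_alg ⊠ mul bialg_alg) ∘ comul2 (comul_on bialg_coalg);
  comul_unit : comul_on bialg_coalg ∘ unit_ bialg_alg
    = (unit_ bialg_alg ⊠ unit_ bialg_alg) ∘ lunitV;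
  counit_mul : counit_on bialg_coalg ∘ mul bialg_alg
    = lunit ∘ (counit_on bialg_coalg ⊠ counit_on bialg_coalg);
  counit_unit : counit_on bialg_coalg ∘ unit_ bialg_alg = idm munit
}.

Definition comul (H : bialgebra) : Mor H (H ⊗ H) := comul_on (bialg_coalg H).
Definition counit (H : bialgebra) : Mor H munit := counit_on (bialg_coalg H).

Record hopfAlgebra := HopfAlgebra {
  hopf_bialg :> bialgebra;
  antipode : Mor hopf_bialg hopf_bialg;
  antipodel : mul hopf_bialg ∘ (antipode ▷ hopf_bialg) ∘ comul hopf_bialg
    = unit_ hopf_bialg ∘ counit hopf_bialg;
  antipoder : mul hopf_bialg ∘ (hopf_bialg ◁ antipode) ∘ comul hopf_bialg
    = unit_ hopf_bialg ∘ counit hopf_bialg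
}.

Section TwistedPartialAction.
Variables (H : hopfAlgebra) (A : algebra C).
Variables (phi : Mor (H ⊗ A) A) (omega : Mor (H ⊗ H) A).

Definition psiHA : Mor (H ⊗ A) (A ⊗ H) :=
  (phi ▷ H) ∘ assocV ∘ (H ◁ braid H A) ∘ assoc ∘ (comul H ▷ A).

Definition sigmaHA : Mor (H ⊗ H) (A ⊗ H) :=
  (omega ⊠ mul H) ∘ comul2 (comul H).

Record twisted_partial_action : Prop := TwistedPartialAction {
  tpa_unit : phi ∘ (unit_ H ▷ A) = lunit;
  tpa_mul : phi ∘ (H ◁ mul A)
    = mul A ∘ (phi ⊠ phi) ∘ mid H A (braid H A) ∘ (comul H ▷ (A ⊗ A));
  tpa_twisted :
    mul A ∘ (A ◁ omega) ∘ assoc ∘ (psiHA ▷ H) ∘ assocV ∘ (H ◁ psiHA) ∘ assoc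
    = mul A ∘ (A ◁ phi) ∘ assoc ∘ (sigmaHA ▷ A);
  tpa_omega :
    omega = mul A ∘ (A ◁ phi) ∘ assoc ∘ (sigmaHA ⊠ unit_ A) ∘ runitV
}.

Definition partial_cocycle : Prop :=
  mul A ∘ (A ◁ omega) ∘ assoc ∘ (psiHA ▷ H) ∘ assocV ∘ (H ◁ sigmaHA) ∘ assoc
  = mul A ∘ (A ◁ omega) ∘ assoc ∘ (sigmaHA ▷ H).

Definition muAH : Mor ((A ⊗ H) ⊗ (A ⊗ H)) (A ⊗ H) :=
  (mul A ▷ H) ∘ assocV ∘ (mul A ⊠ sigmaHA) ∘ mid A H psiHA.

End TwistedPartialAction.

Section WeakCrossedProduct.
Variables (A : algebra C) (V : C).
Variables (psi : Mor (V ⊗ A) (A ⊗ V)) (sigma : Mor (V ⊗ V) (A ⊗ V)).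

Definition psi_multiplicative : Prop :=
  (mul A ▷ V) ∘ assocV ∘ (A ◁ psi) ∘ assoc ∘ (psi ▷ A)
  = psi ∘ (V ◁ mul A) ∘ assoc.

Definition nabla : Mor (A ⊗ V) (A ⊗ V) :=
  (mul A ▷ V) ∘ assocV ∘ (A ◁ psi) ∘ (A ◁ (V ◁ unit_ A)) ∘ (A ◁ runitV).

Definition twisted_condition : Prop :=
  (mul A ▷ V) ∘ assocV ∘ (A ◁ psi) ∘ assoc ∘ (sigma ▷ A)
  = (mul A ▷ V) ∘ assocV ∘ (A ◁ sigma) ∘ assoc ∘ (psi ▷ V) ∘ assocV
      ∘ (V ◁ psi) ∘ assoc.

Definition cocycle_condition : Prop :=
  (mul A ▷ V) ∘ assocV ∘ (A ◁ sigma) ∘ assoc ∘ (sigma ▷ V)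
  = (mul A ▷ V) ∘ assocV ∘ (A ◁ sigma) ∘ assoc ∘ (psi ▷ V) ∘ assocV
      ∘ (V ◁ sigma) ∘ assoc.

Definition wcp_mul : Mor ((A ⊗ V) ⊗ (A ⊗ V)) (A ⊗ V) :=
  (mul A ▷ V) ∘ assocV ∘ (mul A ⊠ sigma) ∘ mid A V psi.

(* wcp_psi and wcp_nabla_sigma are the requirements on the quadruple          *)
(* (A, V, psi, sigma); wcp_nabla_idem is a consequence of wcp_psi.            *)
Record weak_crossed_product (m : Mor ((A ⊗ V) ⊗ (A ⊗ V)) (A ⊗ V)) : Prop :=
  WeakCrossedProduct {
    wcp_psi : psi_multiplicative;
    wcp_nabla_idem : idempotent nabla;
    wcp_nabla_sigma : nabla ∘ sigma = sigma;
    wcp_twisted : twisted_condition;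
    wcp_cocycle : cocycle_condition;
    wcp_mulE : m = wcp_mul
  }.

Definition induced_mul (s : splitting nabla)
    (m : Mor ((A ⊗ V) ⊗ (A ⊗ V)) (A ⊗ V)) :
    Mor (spl_obj s ⊗ spl_obj s) (spl_obj s) :=
  spl_proj s ∘ m ∘ (spl_inj s ⊠ spl_inj s).

End WeakCrossedProduct.
End Braided.
Arguments comul {C} H.
Arguments counit {C} H.

Local Open Scope ring_scope.
Local Open Scope quotient_scope.

Section TensorProduct.
Variable k : comPzRingType.

Definition bilin (M N P : lmodType k) (f : M -> N -> P) : Prop :=
  (forall n, linear (f^~ n)) /\ (forall m, linear (f m)).

Definition bsum (M N P : lmodType k) (f : M -> N -> P) (s : seq (M * N)) : P :=
  \sum_(x <- s) f x.1 x.2.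

Section Carrier.
Variables M N : lmodType k.

(* M ⊗ N is the set of formal sums of pairs (m, n), two of them being         *)
(* identified when no bilinear map tells them apart; tlift below is its       *)
(* universal property.                                                        *)
Definition tensor_rel (s t : seq (M * N)) : bool :=
  `[< forall (P : lmodType k) (f : M -> N -> P), bilin f ->
        bsum f s = bsum f t >].

Lemma tensor_relP s t :
  reflect (forall (P : lmodType k) (f : M -> N -> P), bilin f ->
             bsum f s = bsum f t) (tensor_rel s t).
Proof. exact: asboolP. Qed.

Lemma tensor_rel_refl : reflexive tensor_rel.
Proof. by move=> s; apply/tensor_relP. Qed.

Lemma tensor_rel_sym : symmetric tensor_rel.
Proof.
by move=> s t; apply/tensor_relP/tensor_relP => h P f bf; rewrite h.
Qed.

Lemma tensor_rel_trans : transitive tensor_rel.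
Proof.
move=> t s u /tensor_relP st /tensor_relP tu.
by apply/tensor_relP => P f bf; rewrite st // tu.
Qed.

Canonical tensor_equiv :=
  EquivRel tensor_rel tensor_rel_refl tensor_rel_sym tensor_rel_trans.

Definition tensor : Type := {eq_quot tensor_rel}.
HB.instance Definition _ := Choice.on tensor.
HB.instance Definition _ := EqQuotient.on tensor.

Definition tclass (s : seq (M * N)) : tensor := \pi_tensor s.
Definition tev (P : lmodType k) (f : M -> N -> P) (x : tensor) : P :=
  bsum f (repr x).

Lemma tev_class (P : lmodType k) (f : M -> N -> P) s : bilin f -> tev f (tclass s) = bsum f s.
Proof.
move=> bf; rewrite /tev.
have /eqmodP/tensor_relP -> // : repr (tclass s) = s %[mod tensor].
by rewrite reprK.
Qed.

Lemma tensor_eqP (x y : tensor) :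
  (forall (P : lmodType k) (f : M -> N -> P), bilin f -> tev f x = tev f y) -> x = y.
Proof.
move=> h; rewrite -[x]reprK -[y]reprK.
by apply/eqmodP/tensor_relP => P f bf; apply: h.
Qed.

Definition tzero : tensor := tclass [::].
Definition tadd (x y : tensor) : tensor := tclass (repr x ++ repr y).
Definition tscale (a : k) (x : tensor) : tensor :=
  tclass [seq (a *: z.1, z.2) | z <- repr x].

Lemma bilin_scalel (P : lmodType k) (f : M -> N -> P) a m n :
  bilin f -> f (a *: m) n = a *: f m n.
Proof. by case=> h _; exact: (scalable_linear (h n)). Qed.

Lemma tev0 (P : lmodType k) (f : M -> N -> P) : bilin f -> tev f tzero = 0.
Proof. by move=> bf; rewrite tev_class // /bsum big_nil. Qed.

Lemma tevD (P : lmodType k) (f : M -> N -> P) x y :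
  bilin f -> tev f (tadd x y) = tev f x + tev f y.
Proof. by move=> bf; rewrite tev_class // /bsum big_cat. Qed.

Lemma tevZ (P : lmodType k) (f : M -> N -> P) a x :
  bilin f -> tev f (tscale a x) = a *: tev f x.
Proof.
move=> bf; rewrite tev_class // /bsum big_map scaler_sumr.
by apply: eq_bigr => z _ /=; rewrite bilin_scalel.
Qed.

Let tevE := (tev0, tevD, tevZ).

Lemma taddA : associative tadd.
Proof. by move=> x y z; apply: tensor_eqP => P f bf; rewrite !tevE // addrA. Qed.
Lemma taddC : commutative tadd.
Proof. by move=> x y; apply: tensor_eqP => P f bf; rewrite !tevE // addrC. Qed.
Lemma tadd0 : left_id tzero tadd.
Proof. by move=> x; apply: tensor_eqP => P f bf; rewrite !tevE // add0r. Qed.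
Lemma taddN : left_inverse tzero (tscale (-1)) tadd.
Proof.
by move=> x; apply: tensor_eqP => P f bf; rewrite !tevE // scaleN1r addNr.
Qed.
HB.instance Definition _ := GRing.isZmodule.Build tensor taddA taddC tadd0 taddN.

Lemma tscaleA a b x : tscale a (tscale b x) = tscale (a * b) x.
Proof. by apply: tensor_eqP => P f bf; rewrite !tevE // scalerA. Qed.
Lemma tscale1 : left_id 1 tscale.
Proof. by move=> x; apply: tensor_eqP => P f bf; rewrite !tevE // scale1r. Qed.
Lemma tscaleDr : right_distributive tscale +%R.
Proof.
by move=> a x y; apply: tensor_eqP => P f bf; rewrite !tevE // scalerDr.
Qed.
Lemma tscaleDl x : {morph tscale^~ x : a b / a + b}.
Proof.
by move=> a b; apply: tensor_eqP => P f bf; rewrite !tevE // scalerDl.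
Qed.
HB.instance Definition _ := GRing.Zmodule_isLmodule.Build k tensor
  tscaleA tscale1 tscaleDr tscaleDl.

Definition tpure (m : M) (n : N) : tensor := tclass [:: (m, n)].

Lemma tev_pure (P : lmodType k) (f : M -> N -> P) m n : bilin f -> tev f (tpure m n) = f m n.
Proof. by move=> bf; rewrite tev_class // /bsum big_seq1. Qed.

Lemma tpure_bilin : bilin (tpure : M -> N -> tensor).
Proof.
split=> [n a m m'|m a n n']; apply: tensor_eqP => P f bf;
  rewrite [RHS]tevD // [X in _ = X + _]tevZ // !tev_pure //.
- by case: bf => h _; rewrite -h.
- by case: bf => _ h; rewrite -h.
Qed.

Lemma tev_linear (P : lmodType k) (f : M -> N -> P) : bilin f -> linear (tev f).
Proof. by move=> bf a x y; rewrite [LHS]tevD // [X in X + _]tevZ. Qed.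

Lemma tensor_span (x : tensor) : exists s, x = \sum_(z <- s) tpure z.1 z.2.
Proof.
exists (repr x); apply: tensor_eqP => P f bf.
rewrite {1}/tev /bsum; elim: (repr x) => [|z s IH].
  by rewrite !big_nil [RHS]tev0.
by rewrite !big_cons [RHS]tevD // tev_pure // IH.
Qed.

Definition lin_of (U V : lmodType k) (f : U -> V) (lf : linear f) :
    {linear U -> V} :=
  HB.pack f (GRing.isLinear.Build k U V *:%R f lf).

Definition tlift (P : lmodType k) (f : M -> N -> P) (bf : bilin f) :
    {linear tensor -> P} := lin_of (tev_linear bf).

Lemma tliftE (P : lmodType k) (f : M -> N -> P) (bf : bilin f) m n :
  tlift bf (tpure m n) = f m n.
Proof. exact: tev_pure. Qed.

End Carrier.

Lemma linear_ext (U V : lmodType k) (f g : {linear U -> V}) : f =1 g -> f = g.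
Proof.
case: f g => [f [[fm] [fs]]] [g [[gm] [gs]]] /= /funext efg.
move: gm gs; rewrite -efg => gm gs.
by rewrite (Prop_irrelevance fm gm) (Prop_irrelevance fs gs).
Qed.

Lemma tensor_ext (M N P : lmodType k) (f g : {linear tensor M N -> P}) :
  (forall m n, f (tpure m n) = g (tpure m n)) -> f = g.
Proof.
move=> h; apply: linear_ext => x; have [s ->] := tensor_span x.
by rewrite (raddf_sum f) (raddf_sum g); apply: eq_bigr => z _; apply: h.
Qed.

Lemma tev_linear_param (M N P Q : lmodType k) (f : P -> M -> N -> Q) t :
  (forall m n, linear (fun p => f p m n)) -> linear (fun p => tev (f p) t).
Proof.
move=> h a p q; rewrite /tev /bsum scaler_sumr -big_split /=.
by apply: eq_bigr => z _; rewrite h.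
Qed.

Lemma tpurel (M N : lmodType k) (n : N) : linear (fun m : M => tpure m n).
Proof. exact: (tpure_bilin M N).1. Qed.

Lemma tpurer (M N : lmodType k) (m : M) : linear (fun n : N => tpure m n).
Proof. exact: (tpure_bilin M N).2. Qed.

Section Maps.
Implicit Types M N P Q : lmodType k.

Lemma tmap_bilin M N P Q (f : {linear M -> P}) (g : {linear N -> Q}) :
  bilin (fun m n => tpure (f m) (g n)).
Proof. by split=> [n|m] a x y; rewrite linearP ?tpurel ?tpurer. Qed.

Definition tmap M N P Q (f : {linear M -> P}) (g : {linear N -> Q}) :
  {linear tensor M N -> tensor P Q} := tlift (tmap_bilin f g).

Lemma tassoc_bilin0 M N P (p : P) :
  bilin (fun (m : M) (n : N) => tpure m (tpure n p)).
Proof. by split=> [n|m] a x y; rewrite ?tpurel ?tpurer. Qed.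

Lemma tassoc_bilin M N P :
  bilin (fun t (p : P) => tev (fun (m : M) (n : N) => tpure m (tpure n p)) t).
Proof.
split=> [p|t]; first exact/tev_linear/tassoc_bilin0.
by apply: tev_linear_param => m n a x y; rewrite !tpurer.
Qed.

Definition tassoc M N P :
    {linear tensor (tensor M N) P -> tensor M (tensor N P)} :=
  tlift (tassoc_bilin M N P).

Lemma tassocE M N P (m : M) (n : N) (p : P) :
  tassoc M N P (tpure (tpure m n) p) = tpure m (tpure n p).
Proof. by rewrite tliftE tev_pure //; exact: tassoc_bilin0. Qed.

Lemma tassocV_bilin0 M N P (m : M) :
  bilin (fun (n : N) (p : P) => tpure (tpure m n) p).
Proof. by split=> [n|p] a x y; rewrite ?tpurer ?tpurel. Qed.

Lemma tassocV_bilin M N P :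
  bilin (fun (m : M) t => tev (fun (n : N) (p : P) => tpure (tpure m n) p) t).
Proof.
split=> [t|m]; last exact/tev_linear/tassocV_bilin0.
by apply: tev_linear_param => n p a x y; rewrite !tpurel.
Qed.

Definition tassocV M N P :
    {linear tensor M (tensor N P) -> tensor (tensor M N) P} :=
  tlift (tassocV_bilin M N P).

Lemma tassocVE M N P (m : M) (n : N) (p : P) :
  tassocV M N P (tpure m (tpure n p)) = tpure (tpure m n) p.
Proof. by rewrite tliftE tev_pure //; exact: tassocV_bilin0. Qed.

Lemma tlunit_bilin M : bilin (fun (a : k^o) (m : M) => (a : k) *: m).
Proof.
split=> [m|b] a x y; first by rewrite scalerDl -scalerA.
by rewrite scalerDr !scalerA mulrC.
Qed.

Lemma trunit_bilin M : bilin (fun (m : M) (a : k^o) => (a : k) *: m).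
Proof. by split; have [h1 h2] := tlunit_bilin M. Qed.

Definition tlunit M : {linear tensor k^o M -> M} := tlift (tlunit_bilin M).
Definition trunit M : {linear tensor M k^o -> M} := tlift (trunit_bilin M).
Definition tlunitV M : {linear M -> tensor k^o M} := lin_of (tpurer (1 : k^o)).
Definition trunitV M : {linear M -> tensor M k^o} := lin_of (tpurel (1 : k^o)).

Lemma tlunitE M (a : k^o) (m : M) : tlunit M (tpure a m) = (a : k) *: m.
Proof. exact: tliftE. Qed.

Lemma trunitE M (a : k^o) (m : M) : trunit M (tpure m a) = (a : k) *: m.
Proof. exact: tliftE. Qed.

Lemma tpure_scale M N (a : k) (m : M) (n : N) :
  tpure (a *: m) n = tpure m (a *: n).
Proof.
by rewrite (scalable_linear (tpurel n)) (scalable_linear (tpurer m)).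
Qed.

Lemma tlunitVE M (m : M) : tlunitV M m = tpure (1 : k^o) m.
Proof. by []. Qed.

Lemma trunitVE M (m : M) : trunitV M m = tpure m (1 : k^o).
Proof. by []. Qed.

Lemma tswap_bilin M N : bilin (fun (m : M) (n : N) => tpure n m).
Proof. by split=> [n|m] a x y; rewrite ?tpurel ?tpurer. Qed.

Definition tswap M N : {linear tensor M N -> tensor N M} :=
  tlift (tswap_bilin M N).

Lemma tswapE M N (m : M) (n : N) : tswap M N (tpure m n) = tpure n m.
Proof. exact: tliftE. Qed.

Lemma tmapE M N P Q (f : {linear M -> P}) (g : {linear N -> Q}) m n :
  tmap f g (tpure m n) = tpure (f m) (g n).
Proof. exact: tliftE. Qed.

Definition lcomp M N P (g : {linear N -> P}) (f : {linear M -> N}) :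
  {linear M -> P} := g \o f.
Definition lid M : {linear M -> M} := idfun.

Lemma lcompE M N P (g : {linear N -> P}) (f : {linear M -> N}) x :
  lcomp g f x = g (f x).
Proof. by []. Qed.

Lemma lidE M (x : M) : lid M x = x.
Proof. by []. Qed.

Definition tE := (lcompE, lidE, tmapE, tassocE, tassocVE, tlunitE, trunitE,
  tlunitVE, trunitVE, tswapE).

Lemma tensor_ext3 M N P Q (f g : {linear tensor (tensor M N) P -> Q}) :
  (forall m n p, f (tpure (tpure m n) p) = g (tpure (tpure m n) p)) -> f = g.
Proof.
move=> h; apply: tensor_ext => t p; have [s ->] := tensor_span t.
have -> : tpure (\sum_(z <- s) tpure z.1 z.2) p =
          \sum_(z <- s) tpure (tpure z.1 z.2) p.
  exact: (raddf_sum (lin_of (tpurel p))).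
by rewrite (raddf_sum f) (raddf_sum g); apply: eq_bigr => z _; apply: h.
Qed.

Lemma tensor_ext3r M N P Q (f g : {linear tensor M (tensor N P) -> Q}) :
  (forall m n p, f (tpure m (tpure n p)) = g (tpure m (tpure n p))) -> f = g.
Proof.
move=> h; apply: tensor_ext => m t; have [s ->] := tensor_span t.
have -> : tpure m (\sum_(z <- s) tpure z.1 z.2) =
          \sum_(z <- s) tpure m (tpure z.1 z.2).
  exact: (raddf_sum (lin_of (tpurer m))).
by rewrite (raddf_sum f) (raddf_sum g); apply: eq_bigr => z _; apply: h.
Qed.

Lemma tensor_ext4 M N P Q (R : lmodType k)
    (f g : {linear tensor (tensor (tensor M N) P) Q -> R}) :
  (forall m n p q, f (tpure (tpure (tpure m n) p) q) =
                   g (tpure (tpure (tpure m n) p) q)) -> f = g.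
Proof.
move=> h; apply: tensor_ext3 => t p q; have [s ->] := tensor_span t.
have -> : tpure (tpure (\sum_(z <- s) tpure z.1 z.2) p) q =
          \sum_(z <- s) tpure (tpure (tpure z.1 z.2) p) q.
  exact: (raddf_sum (lcomp (lin_of (tpurel q)) (lin_of (tpurel p)))).
by rewrite (raddf_sum f) (raddf_sum g); apply: eq_bigr => z _; apply: h.
Qed.

Lemma tmap_id M N : tmap (lid M) (lid N) = lid (tensor M N).
Proof. by apply: tensor_ext => m n; rewrite !tE. Qed.

Lemma tmap_comp M N P M' N' P' (g : {linear N -> P}) (f : {linear M -> N})
    (g' : {linear N' -> P'}) (f' : {linear M' -> N'}) :
  tmap (lcomp g f) (lcomp g' f') = lcomp (tmap g g') (tmap f f').
Proof. by apply: tensor_ext => m n; rewrite !tE. Qed.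

Lemma tassocK M N P : lcomp (tassocV M N P) (tassoc M N P) = lid _.
Proof. by apply: tensor_ext3 => m n p; rewrite !tE. Qed.

Lemma tassocVK M N P : lcomp (tassoc M N P) (tassocV M N P) = lid _.
Proof. by apply: tensor_ext3r => m n p; rewrite !tE. Qed.

Lemma tlunitK M : lcomp (tlunitV M) (tlunit M) = lid _.
Proof.
apply: tensor_ext => a m; rewrite !tE -tpure_scale.
by rewrite /GRing.scale /= mulr1.
Qed.

Lemma tlunitVK M : lcomp (tlunit M) (tlunitV M) = lid _.
Proof. by apply: linear_ext => m; rewrite !tE scale1r. Qed.

Lemma trunitK M : lcomp (trunitV M) (trunit M) = lid _.
Proof.
apply: tensor_ext => m a; rewrite !tE tpure_scale.
by rewrite /GRing.scale /= mulr1.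
Qed.

Lemma trunitVK M : lcomp (trunit M) (trunitV M) = lid _.
Proof. by apply: linear_ext => m; rewrite !tE scale1r. Qed.

Lemma tassoc_nat M N P M' N' P' (f : {linear M -> M'})
    (g : {linear N -> N'}) (h : {linear P -> P'}) :
  lcomp (tassoc M' N' P') (tmap (tmap f g) h)
  = lcomp (tmap f (tmap g h)) (tassoc M N P).
Proof. by apply: tensor_ext3 => m n p; rewrite !tE. Qed.

Lemma tlunit_nat M N (f : {linear M -> N}) :
  lcomp (tlunit N) (tmap (lid k^o) f) = lcomp f (tlunit M).
Proof. by apply: tensor_ext => a m; rewrite !tE linearZ. Qed.

Lemma trunit_nat M N (f : {linear M -> N}) :
  lcomp (trunit N) (tmap f (lid k^o)) = lcomp f (trunit M).
Proof. by apply: tensor_ext => m a; rewrite !tE linearZ. Qed.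

Lemma tpentagon M N P Q :
  lcomp (lcomp (tmap (lid M) (tassoc N P Q)) (tassoc M (tensor N P) Q))
    (tmap (tassoc M N P) (lid Q))
  = lcomp (tassoc M N (tensor P Q)) (tassoc (tensor M N) P Q).
Proof. by apply: tensor_ext4 => m n p q; rewrite !tE. Qed.

Lemma ttriangle M N :
  lcomp (tmap (lid M) (tlunit N)) (tassoc M k^o N) = tmap (trunit M) (lid N).
Proof. by apply: tensor_ext3 => m a n; rewrite !tE tpure_scale. Qed.

Lemma tswapK M N : lcomp (tswap N M) (tswap M N) = lid _.
Proof. by apply: tensor_ext => m n; rewrite !tE. Qed.

Lemma tswap_nat M N M' N' (f : {linear M -> M'}) (g : {linear N -> N'}) :
  lcomp (tswap M' N') (tmap f g) = lcomp (tmap g f) (tswap M N).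
Proof. by apply: tensor_ext => m n; rewrite !tE. Qed.

Lemma thexagon1 M N P :
  lcomp (lcomp (tassoc N P M) (tswap M (tensor N P))) (tassoc M N P)
  = lcomp (lcomp (tmap (lid N) (tswap M P)) (tassoc N M P))
      (tmap (tswap M N) (lid P)).
Proof. by apply: tensor_ext3 => m n p; rewrite !tE. Qed.

Lemma thexagon2 M N P :
  lcomp (lcomp (tassocV P M N) (tswap (tensor M N) P)) (tassocV M N P)
  = lcomp (lcomp (tmap (tswap M P) (lid N)) (tassocV M P N))
      (tmap (lid M) (tswap N P)).
Proof. by apply: tensor_ext3r => m n p; rewrite !tE. Qed.

Lemma lcomp_idl M N (f : {linear M -> N}) : lcomp (lid N) f = f.
Proof. exact: linear_ext. Qed.

Lemma lcomp_idr M N (f : {linear M -> N}) : lcomp f (lid M) = f.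
Proof. exact: linear_ext. Qed.

Lemma lcompA M N P Q (h : {linear P -> Q}) (g : {linear N -> P})
    (f : {linear M -> N}) : lcomp h (lcomp g f) = lcomp (lcomp h g) f.
Proof. exact: linear_ext. Qed.

End Maps.

Definition mod_category : category :=
  Category lcomp_idl lcomp_idr lcompA.

Definition mod_monoidalCat : monoidalCat :=
  @MonoidalCat mod_category (fun M N => tensor M N : lmodType k)
    (fun M P N Q f g => tmap f g) (k^o : lmodType k)
    tassoc tassocV tlunit tlunitV trunit trunitV
    tmap_id tmap_comp tassocK tassocVK tlunitK tlunitVK trunitK trunitVK
    tassoc_nat tlunit_nat trunit_nat tpentagon ttriangle.

Definition mod_braidedCat : braidedCat :=
  @BraidedCat mod_monoidalCat tswap (fun M N => tswap N M)
    tswapK (fun M N => tswapK N M) tswap_nat thexagon1 thexagon2.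

Section FixedSubmodule.
Variables (M : lmodType k) (e : {linear M -> M}).

Definition fixed_pred : pred M := [pred x | e x == x].

Lemma fixed_submod_closed : GRing.submod_closed fixed_pred.
Proof.
split=> [|a x y]; rewrite !inE ?linear0 // => /eqP ex /eqP ey.
by rewrite linearP ex ey.
Qed.

HB.instance Definition _ := GRing.isSubmodClosed.Build k M fixed_pred
  (GRing.submod_closed_semi fixed_submod_closed).

Record fixedmod := Fixedmod { fixed_val : M; _ : fixed_val \in fixed_pred }.
HB.instance Definition _ := [isSub for fixed_val].
HB.instance Definition _ := [Choice of fixedmod by <:].
HB.instance Definition _ := [SubChoice_isSubLmodule of fixedmod by <:].

Lemma fixed_splitting : lcomp e e = e ->
  inhabited (@splitting mod_category M e).
Proof.
move=> ee.
have eex x : e x \in fixed_pred by rewrite inE -{3}ee.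
have lin_p : linear (fun x => Fixedmod (eex x)).
  by move=> a x y; apply: val_inj; rewrite /= linearP.
have lin_i : linear fixed_val by exact: (linearP (val : fixedmod -> M)).
split; apply: (@Splitting mod_category M e (fixedmod : lmodType k)
  (lin_of lin_i) (lin_of lin_p)).
- exact: linear_ext.
- by apply: linear_ext => x; apply: val_inj => /=; apply/eqP; case: x.
Qed.
End FixedSubmodule.

Lemma mod_idempotents_split : idempotents_split mod_braidedCat.
Proof. by move=> M e; apply: fixed_splitting. Qed.

End TensorProduct.

Arguments tpure {k M N} m n.

(* elt and ap are identities up to unfolding mod_braidedCat: its objects are  *)
(* the k-modules and its morphisms the k-linear maps.                         *)
Definition elt (k : comPzRingType) (M : mod_braidedCat k) : lmodType k := M.
Definition ap (k : comPzRingType) (M N : mod_braidedCat k)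
  (f : Mor M N) : elt M -> elt N := (f : {linear elt M -> elt N}).
Definition pure (k : comPzRingType) (M N : mod_braidedCat k)
  (m : elt M) (n : elt N) : elt (M ⊗ N)%C := tpure m n.
Definition amul (k : comPzRingType) (A : algebra (mod_braidedCat k))
  (a b : elt A) : elt A := ap (mul A) (pure a b).

(* Main.v *)
Require Import Defs.
From HB Require Import structures.
From mathcomp Require Import all_boot all_order all_algebra.
Import Defs.

Set Implicit Arguments.
Unset Strict Implicit.
Unset Printing Implicit Defensive.

Local Open Scope cat_scope.

(* The coaction of H on a tensor product of right H-comodules is built from   *)
(* the braiding and the product of H.  Let H coact on itself by its coproduct *)
(* and trivially on A.  Then psiHA : H ⊗ A -> A ⊗ H and                       *)
(* sigmaHA : H ⊗ H -> A ⊗ H are colinear, and so is every composite occurring *)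
(* in the axioms of a weak crossed product.  Since A ⊗ H is the cofree        *)
(* comodule on A, two colinear maps into it agree as soon as their composites *)
(* with A ⊗ ε do, and these composites are exactly the two sides of the       *)
(* axioms of a twisted partial action and of the partial cocycle condition.   *)
(* Associativity of the product of a weak crossed product is a diagram chase; *)
(* it passes to A × H because nabla ∘ muAH = muAH.                            *)

(** The axioms of a weak crossed product (multiplicativity of [psi], the twisted and cocycle
    conditions, [nabla ∘ sigma = sigma]) are equations between maps into A ⊗ H, whereas the
    hypotheses are equations between maps into A. Composing with A ⊗ ε turns each axiom into a
    hypothesis, and nothing is lost: A ⊗ H is the cofree right H-comodule on A and both sides are
    colinear for the diagonal coaction, so [cofree_inj] applies. The maps [psiHA] and [sigmaHA] are
    exactly the colinear lifts of [phi] and [omega] ([psiHA_coact], [sigmaHA_coact]). The bialgebra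
    axioms make the diagonal coaction a coaction ([coassociative_tens], [counital_tens]), compatible
    with rebracketing ([colinear_assoc]).

    The rest holds for any quadruple: [wcp_mulA] proves associativity on A ⊗ V, and [nabla_wcp_mul]
    carries it to the split object in [induced_mulA]. The formula for modules, [muAH_pure], is an
    evaluation on pure tensors. As the categories are not strict, diagrams are computed in
    coordinates where the constraints become identities. *)

Section Whisker.
Variable C : monoidalCat.
Implicit Types X Y Z W : C.

Lemma whiskerl_comp X Y Z W (g : Mor Z W) (f : Mor Y Z) :
  X ◁ (g ∘ f) = (X ◁ g) ∘ (X ◁ f).
Proof. by rewrite -tensm_comp comp_idl. Qed.

Lemma whiskerr_comp X Y Z W (g : Mor Z W) (f : Mor Y Z) :
  (g ∘ f) ▷ X = (g ▷ X) ∘ (f ▷ X).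
Proof. by rewrite -tensm_comp comp_idl. Qed.

Lemma tensm_whiskerlr X X' Y Y' (f : Mor X X') (g : Mor Y Y') :
  f ⊠ g = (X' ◁ g) ∘ (f ▷ Y).
Proof. by rewrite -tensm_comp comp_idl comp_idr. Qed.

Lemma tensm_whiskerrl X X' Y Y' (f : Mor X X') (g : Mor Y Y') :
  f ⊠ g = (f ▷ Y') ∘ (X ◁ g).
Proof. by rewrite -tensm_comp comp_idl comp_idr. Qed.

(* Composites are kept bracketed to the right.  The lemmas tailed apply an    *)
(* equation inside such a composite, and the lemmas whisker do so under a     *)
(* whiskering X ◁ -.                                                          *)
Lemma tailed X Y Z (g : Mor Y Z) (f : Mor X Y) (k : Mor X Z) :
  g ∘ f = k -> forall W (t : Mor W X), g ∘ (f ∘ t) = k ∘ t.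
Proof. by move=> <- W t; rewrite compA. Qed.

Lemma comp_tail_inj X Y (f g : Mor X Y) :
  (forall Z (t : Mor Z X), f ∘ t = g ∘ t) -> f = g.
Proof. by move=> e; rewrite -[f]comp_idr -[g]comp_idr e. Qed.

Lemma whisker2 X Y Y' Z (g : Mor Y' Z) (f : Mor Y Y') (k : Mor Y Z) :
  g ∘ f = k -> (X ◁ g) ∘ (X ◁ f) = X ◁ k.
Proof. by move=> <-; rewrite whiskerl_comp. Qed.

Lemma whisker3 X Y Y' Z Z' (h : Mor Z Z') (g : Mor Y' Z) (f : Mor Y Y')
    (k : Mor Y Z') :
  h ∘ (g ∘ f) = k -> (X ◁ h) ∘ ((X ◁ g) ∘ (X ◁ f)) = X ◁ k.
Proof. by move=> <-; rewrite !whiskerl_comp. Qed.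

Lemma whisker4 X Y Y1 Y2 Y3 Z (i : Mor Y3 Z) (h : Mor Y2 Y3) (g : Mor Y1 Y2)
    (f : Mor Y Y1) (k : Mor Y Z) :
  i ∘ (h ∘ (g ∘ f)) = k ->
  (X ◁ i) ∘ ((X ◁ h) ∘ ((X ◁ g) ∘ (X ◁ f))) = X ◁ k.
Proof. by move=> <-; rewrite !whiskerl_comp. Qed.

Lemma tailed4 X Y1 Y2 Y3 Z (i : Mor Y3 Z) (h : Mor Y2 Y3) (g : Mor Y1 Y2)
    (f : Mor X Y1) (k : Mor X Z) :
  i ∘ (h ∘ (g ∘ f)) = k ->
  forall W (t : Mor W X), i ∘ (h ∘ (g ∘ (f ∘ t))) = k ∘ t.
Proof. by move=> <- W t; rewrite !compA. Qed.

Lemma tailed3 X Y Y' Z (h : Mor Y' Z) (g : Mor Y Y') (f : Mor X Y)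
    (k : Mor X Z) :
  h ∘ (g ∘ f) = k -> forall W (t : Mor W X), h ∘ (g ∘ (f ∘ t)) = k ∘ t.
Proof. by move=> <- W t; rewrite !compA. Qed.

Lemma unit_whiskerl_inj X Y (f g : Mor X Y) :
  munit ◁ f = munit ◁ g -> f = g.
Proof.
move=> e; rewrite -[f]comp_idr -[g]comp_idr -lunitVK !compA -!lunit_nat.
by rewrite e.
Qed.

Lemma unit_whiskerr_inj X Y (f g : Mor X Y) :
  f ▷ munit = g ▷ munit -> f = g.
Proof.
move=> e; rewrite -[f]comp_idr -[g]comp_idr -runitVK !compA -!runit_nat.
by rewrite e.
Qed.

Lemma epi_iso X Y Z (u : Mor X Y) (v : Mor Y X) (f g : Mor Y Z) :
  u ∘ v = idm _ -> f ∘ u = g ∘ u -> f = g.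
Proof. by move=> uv e; rewrite -[f]comp_idr -[g]comp_idr -uv !compA e. Qed.

(* Kelly's argument: the pentagon on 1, 1, X, Y and the triangle. *)
Lemma lunit_assoc X Y : lunit ∘ assoc = lunit (X := X) ▷ Y.
Proof.
have K : (assoc ∘ (assoc ▷ Y)) ∘ ((assocV ▷ Y) ∘ assocV)
    = idm (munit ⊗ ((munit ⊗ X) ⊗ Y)).
  rewrite -!compA (compA (assoc ▷ Y)) -whiskerr_comp assocVK tensm_id comp_idl.
  exact: assocVK.
apply: unit_whiskerl_inj; apply: (epi_iso K); rewrite whiskerl_comp.
rewrite -!compA (compA (_ ◁ assoc)) pentagon compA triangle.
rewrite -tensm_id -assoc_nat.
rewrite [RHS]compA -assoc_nat -compA -whiskerr_comp triangle.
by [].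
Qed.
End Whisker.

Arguments whisker2 {C X Y Y' Z g f k} _.
Arguments whisker4 {C X Y Y1 Y2 Y3 Z i h g f k} _.
Arguments whisker3 {C X Y Y' Z Z' h g f k} _.

(** * Coordinates free of associators *)

Section Tail.
Variable C : monoidalCat.
Implicit Types X Y Z W : C.

(* [pobj P W] is the object X ⊗ W rebracketed to the right according to a     *)
(* bracketing P of X.  In these coordinates the associativity and unit        *)
(* constraints become identities.                                             *)
Record pres X := Pres {
  pobj : C -> C;
  pmap : forall W W', Mor W W' -> Mor (pobj W) (pobj W');
  piso : forall W, Mor (X ⊗ W) (pobj W);
  pisoV : forall W, Mor (pobj W) (X ⊗ W);
  pisoK : forall W, pisoV W ∘ piso W = idm _;
  pisoVK : forall W, piso W ∘ pisoV W = idm _;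
  piso_nat : forall W W' (t : Mor W W'), piso W' ∘ (X ◁ t) = pmap t ∘ piso W
}.

Definition prim X : pres X.
Proof.
apply: (@Pres X (tens X) (fun W W' t => X ◁ t) (fun W => idm _) (fun W => idm _)).
- by move=> W; rewrite comp_idl.
- by move=> W; rewrite comp_idl.
- by move=> W W' t; rewrite comp_idl comp_idr.
Defined.

Definition punit : pres munit.
Proof.
exact: (@Pres munit id (fun W W' t => t) (@lunit C) (@lunitV C) (@lunitK C)
  (@lunitVK C) (@lunit_nat C)).
Defined.

Definition ptens X Y (P : pres X) (Q : pres Y) : pres (X ⊗ Y).
Proof.
apply: (@Pres (X ⊗ Y) (fun W => pobj P (pobj Q W))
  (fun W W' t => pmap P (pmap Q t))
  (fun W => piso P (pobj Q W) ∘ (X ◁ piso Q W) ∘ assoc)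
  (fun W => assocV ∘ (X ◁ pisoV Q W) ∘ pisoV P (pobj Q W))).
- move=> W; rewrite -!compA (tailed (pisoK P _)) comp_idl.
  rewrite (compA (_ ◁ _) (_ ◁ _)) -whiskerl_comp pisoK tensm_id.
  by rewrite comp_idl assocK.
- move=> W; rewrite -!compA (tailed (assocVK _ _ _)) comp_idl.
  rewrite (compA (_ ◁ _) (_ ◁ _)) -whiskerl_comp pisoVK tensm_id comp_idl.
  exact: pisoVK.
- move=> W W' t; rewrite -!compA -(tensm_id X Y) assoc_nat.
  rewrite (compA (_ ◁ _) (_ ◁ _)) -whiskerl_comp piso_nat whiskerl_comp.
  by rewrite !compA piso_nat.
Defined.

(** [F W] is [f ▷ W] read in coordinates. The spectator [W] stands for whatever lies to the right of
    the factors on which [f] acts, so a morphism acting in the middle of a tensor word becomes a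
    whiskering of some [F W]. *)
Definition tail_of X Y (P : pres X) (Q : pres Y) (f : Mor X Y)
    (F : forall W, Mor (pobj P W) (pobj Q W)) : Prop :=
  forall W, F W ∘ piso P W = piso Q W ∘ (f ▷ W).
Arguments tail_of {X Y} P Q f F.

(* Sealed, so that rewriting does not see through it.                         *)
Fact tail_exists X Y (P : pres X) (Q : pres Y) (f : Mor X Y) :
  {F | tail_of P Q f F}.
Proof.
exists (fun W => piso Q W ∘ (f ▷ W) ∘ pisoV P W) => W.
by rewrite -!compA pisoK comp_idr.
Qed.

Definition tl X Y (P : pres X) (Q : pres Y) (f : Mor X Y) W :
    Mor (pobj P W) (pobj Q W) :=
  sval (tail_exists P Q f) W.

Lemma tail_of_tl X Y (P : pres X) (Q : pres Y) (f : Mor X Y) :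
  tail_of P Q f (tl P Q f).
Proof. exact: svalP. Qed.

Lemma pisoVI X (P : pres X) W Y (f g : Mor Y (X ⊗ W)) :
  piso P W ∘ f = piso P W ∘ g -> f = g.
Proof. by move=> e; rewrite -[f]comp_idl -[g]comp_idl -(pisoK P W) -!compA e. Qed.

(** The component at [W = munit] already determines the morphism. *)
Lemma tail_of_inj X Y (P : pres X) (Q : pres Y) (f g : Mor X Y) F G :
  tail_of P Q f F -> tail_of P Q g G -> (forall W, F W = G W) -> f = g.
Proof.
move=> RF RG e; apply: unit_whiskerr_inj; apply: (pisoVI (P := Q)).
by rewrite -RF -RG e.
Qed.

Lemma tail_of_eq X Y (P : pres X) (Q : pres Y) (f g : Mor X Y) F G :
  f = g -> tail_of P Q f F -> tail_of P Q g G -> forall W, F W = G W.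
Proof.
move=> <- RF RG W; apply: (epi_iso (pisoVK P W)).
by rewrite RF RG.
Qed.

(** This is the interchange law: [f] commutes with anything done to its right. *)
Lemma tail_of_nat X Y (P : pres X) (Q : pres Y) (f : Mor X Y) F :
  tail_of P Q f F ->
  forall W W' (t : Mor W W'), F W' ∘ pmap P t = pmap Q t ∘ F W.
Proof.
move=> RF W W' t; apply: (epi_iso (pisoVK P W)).
rewrite -!compA -piso_nat RF [LHS]compA RF -compA.
by rewrite [RHS]compA -piso_nat -compA -tensm_whiskerrl -tensm_whiskerlr.
Qed.

Lemma tail_of_id X (P : pres X) : tail_of P P (idm X) (fun W => idm _).
Proof. by move=> W; rewrite tensm_id comp_idl comp_idr. Qed.

Lemma tail_of_comp X Y Z (P : pres X) (Q : pres Y) (S : pres Z)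
    (g : Mor Y Z) (f : Mor X Y) F G :
  tail_of P Q f F -> tail_of Q S g G ->
  tail_of P S (g ∘ f) (fun W => G W ∘ F W).
Proof. by move=> RF RG W; rewrite -compA RF compA RG -compA whiskerr_comp. Qed.

Lemma tail_of_whiskerl X Y Y' (P : pres X) (Q : pres Y) (Q' : pres Y')
    (g : Mor Y Y') G :
  tail_of Q Q' g G ->
  tail_of (ptens P Q) (ptens P Q') (X ◁ g) (fun W => pmap P (G W)).
Proof.
move=> RG W /=; rewrite -!compA assoc_nat !compA -piso_nat.
by rewrite -!(compA (piso P _)) -!whiskerl_comp RG.
Qed.

Lemma tail_of_whiskerr X X' Y (P : pres X) (P' : pres X') (Q : pres Y)
    (f : Mor X X') F :
  tail_of P P' f F ->
  tail_of (ptens P Q) (ptens P' Q) (f ▷ Y) (fun W => F (pobj Q W)).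
Proof.
move=> RF W /=; rewrite -!compA assoc_nat tensm_id !compA RF.
by rewrite -!compA; congr comp; rewrite !compA -tensm_whiskerlr -tensm_whiskerrl.
Qed.

Lemma tail_of_tens X X' Y Y' (P : pres X) (P' : pres X') (Q : pres Y)
    (Q' : pres Y') (f : Mor X X') (g : Mor Y Y') F G :
  tail_of P P' f F -> tail_of Q Q' g G ->
  tail_of (ptens P Q) (ptens P' Q') (f ⊠ g)
    (fun W => F (pobj Q' W) ∘ pmap P (G W)).
Proof.
move=> RF RG; rewrite tensm_whiskerrl.
exact: tail_of_comp (tail_of_whiskerl P RG) (tail_of_whiskerr Q' RF).
Qed.

(** Both bracketings have the same [pobj]; that the comparison is the identity is the pentagon. *)
Lemma tail_of_assoc X Y Z (P : pres X) (Q : pres Y) (S : pres Z) :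
  tail_of (ptens (ptens P Q) S) (ptens P (ptens Q S)) assoc (fun W => idm _).
Proof.
move=> W; rewrite comp_idl /= !whiskerl_comp -!compA; congr comp; congr comp.
rewrite [LHS]compA -tensm_id assoc_nat -compA; congr comp.
by rewrite !compA pentagon.
Qed.

Lemma tail_of_inv X Y (P : pres X) (Q : pres Y) (f : Mor X Y) (g : Mor Y X) F G :
  f ∘ g = idm _ -> (forall W, G W ∘ F W = idm _) ->
  tail_of P Q f F -> tail_of Q P g G.
Proof.
move=> fg GF RF W.
rewrite -[RHS]comp_idl -(GF W) -!compA (tailed (RF W)) -compA.
by rewrite -whiskerr_comp fg tensm_id comp_idr.
Qed.

Lemma tail_of_assocV X Y Z (P : pres X) (Q : pres Y) (S : pres Z) :
  tail_of (ptens P (ptens Q S)) (ptens (ptens P Q) S) assocV (fun W => idm _).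
Proof.
apply: tail_of_inv (assocVK X Y Z) _ (tail_of_assoc P Q S) => W.
exact: comp_idl.
Qed.

(** Here Kelly's identity [lunit_assoc] enters; for [runit] the triangle suffices. *)
Lemma tail_of_lunit X (P : pres X) :
  tail_of (ptens punit P) P lunit (fun W => idm _).
Proof. by move=> W; rewrite comp_idl /= lunit_nat -compA lunit_assoc. Qed.

Lemma tail_of_runit X (P : pres X) :
  tail_of (ptens P punit) P runit (fun W => idm _).
Proof. by move=> W; rewrite comp_idl /= -compA triangle. Qed.

Lemma tail_of_lunitV X (P : pres X) :
  tail_of P (ptens punit P) lunitV (fun W => idm _).
Proof.
apply: tail_of_inv (lunitVK X) _ (tail_of_lunit P) => W; exact: comp_idl.
Qed.

Lemma tail_of_runitV X (P : pres X) :
  tail_of P (ptens P punit) runitV (fun W => idm _).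
Proof.
apply: tail_of_inv (runitVK X) _ (tail_of_runit P) => W; exact: comp_idl.
Qed.
End Tail.

Arguments punit {C}.
Arguments tail_of {C X Y} P Q f F.
Arguments tl {C X Y} P Q f W : simpl never.

(** * Tactics passing between morphisms and their coordinates *)

Ltac pres_of Y :=
  lazymatch Y with
  | tens ?a ?b => let p := pres_of a in let q := pres_of b in
                  constr:(ptens p q)
  | @munit ?C => constr:(@punit C)
  | _ => constr:(prim Y)
  end.

(** Computes the coordinates of a morphism by recursion on its syntax: constraints contribute
    identities, and any morphism that is not a composite or a tensor becomes an opaque [tl]. *)
Ltac present :=
  lazymatch goal with
  | |- tail_of _ _ (idm _) _ => apply: tail_of_id
  | |- tail_of _ _ (comp _ _) _ =>
      refine (@tail_of_comp _ _ _ _ _ _ _ _ _ _ _ _ _); [present | present]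
  | |- tail_of _ _ assoc _ => apply: tail_of_assoc
  | |- tail_of _ _ assocV _ => apply: tail_of_assocV
  | |- tail_of _ _ lunit _ => apply: tail_of_lunit
  | |- tail_of _ _ lunitV _ => apply: tail_of_lunitV
  | |- tail_of _ _ runit _ => apply: tail_of_runit
  | |- tail_of _ _ runitV _ => apply: tail_of_runitV
  | |- tail_of _ _ (tensm (idm _) _) _ =>
      refine (@tail_of_whiskerl _ _ _ _ _ _ _ _ _ _); present
  | |- tail_of _ _ (tensm _ (idm _)) _ => refine (@tail_of_whiskerr _ _ _ _ _ _ _ _ _ _); present
  | |- tail_of _ _ (tensm _ _) _ =>
      refine (@tail_of_tens _ _ _ _ _ _ _ _ _ _ _ _ _ _ _); [present | present]
  | |- @tail_of ?C ?X ?Y ?P ?Q ?f _ =>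
      let q := pres_of Y in exact (@tail_of_tl C X Y P q f)
  end.

Ltac tidy := rewrite ?(tensm_id, comp_idl, comp_idr).

Ltac unstrict :=
  lazymatch goal with
  | |- @eq (@Mor _ ?X ?Y) ?f ?g =>
      let p := pres_of X in let q := pres_of Y in
      eapply (@tail_of_inj _ X Y p q f g); [present | present |];
      let W := fresh "W" in
      move=> W; cbn [pobj pmap prim punit ptens]; tidy
  end.

(** Transports a known equation [e] to coordinates, as [unstrict] does for the goal. *)
Ltac strict e :=
  lazymatch type of e with
  | @eq (@Mor _ ?X ?Y) ?f ?g =>
      let p := pres_of X in let q := pres_of Y in
      let e' := fresh in
      epose proof (@tail_of_eq _ X Y p q f g _ _ e
        ltac:(present) ltac:(present)) as e';
      cbn [pobj pmap prim punit ptens] in e'; move: e'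
  end.

Ltac rassoc := rewrite ?whiskerl_comp -?compA.

Ltac unstrict_tail :=
  unstrict;
  let Z := fresh "Z" in let z := fresh "z" in
  apply: comp_tail_inj => Z z; rassoc.

(** The two digits count the tensor factors of the source and of the target. *)
Notation t01 f := (tl punit (prim _) f).
Notation t10 f := (tl (prim _) punit f).
Notation t11 f := (tl (prim _) (prim _) f).
Notation t12 f := (tl (prim _) (ptens (prim _) (prim _)) f).
Notation t21 f := (tl (ptens (prim _) (prim _)) (prim _) f).
Notation t22 f := (tl (ptens (prim _) (prim _)) (ptens (prim _) (prim _)) f).

Section TailNaturality.
Variable C : monoidalCat.
Implicit Types X Y Z T W : C.

Lemma tl_nat X Y (P : pres X) (Q : pres Y) (f : Mor X Y) W W' (t : Mor W W') :
  tl P Q f W' ∘ pmap P t = pmap Q t ∘ tl P Q f W.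
Proof. exact/tail_of_nat/tail_of_tl. Qed.

Lemma t11_nat X Y (f : Mor X Y) W W' (t : Mor W W') :
  t11 f W' ∘ (X ◁ t) = (Y ◁ t) ∘ t11 f W.
Proof. exact: (@tl_nat _ _ (prim _) (prim _)). Qed.

Lemma t12_nat X Y Z (f : Mor X (Y ⊗ Z)) W W' (t : Mor W W') :
  t12 f W' ∘ (X ◁ t) = (Y ◁ (Z ◁ t)) ∘ t12 f W.
Proof. exact: (@tl_nat _ _ (prim _) (ptens (prim _) (prim _))). Qed.

Lemma t21_nat X Y Z (f : Mor (X ⊗ Y) Z) W W' (t : Mor W W') :
  t21 f W' ∘ (X ◁ (Y ◁ t)) = (Z ◁ t) ∘ t21 f W.
Proof. exact: (@tl_nat _ _ (ptens (prim _) (prim _)) (prim _)). Qed.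

Lemma t22_nat X Y Z T (f : Mor (X ⊗ Y) (Z ⊗ T)) W W' (t : Mor W W') :
  t22 f W' ∘ (X ◁ (Y ◁ t)) = (Z ◁ (T ◁ t)) ∘ t22 f W.
Proof.
exact: (@tl_nat _ _ (ptens (prim _) (prim _)) (ptens (prim _) (prim _))).
Qed.
End TailNaturality.

(** * The braiding in coordinates *)

Section Braiding.
Variable C : braidedCat.
Implicit Types X Y Z T W : C.

Lemma braid_tensr X Y Z :
  braid X (Y ⊗ Z)
  = assocV ∘ (Y ◁ braid X Z) ∘ assoc ∘ (braid X Y ▷ Z) ∘ assocV.
Proof.
rewrite -!compA (compA _ assoc) (compA (_ ∘ assoc)) -hexagon1 -!compA.
by rewrite assocVK comp_idr compA assocK comp_idl.
Qed.

Lemma braid_tensl X Y Z :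
  braid (X ⊗ Y) Z
  = assoc ∘ (braid X Z ▷ Y) ∘ assocV ∘ (X ◁ braid Y Z) ∘ assoc.
Proof.
rewrite -!compA (compA _ assocV) (compA (_ ∘ assocV)) -hexagon2 -!compA.
by rewrite assocK comp_idr compA assocVK comp_idl.
Qed.

(** In coordinates, naturality along [lunit : 1 ⊗ 1 -> 1] and the hexagon say that the braiding b
    satisfies b = b ∘ b. Since b is invertible, it is the identity. *)
Lemma braid_unitl X : braid munit X = runitV ∘ lunit.
Proof.
have b1 W : tl (ptens punit (prim X)) (ptens (prim X) punit) (braid munit X) W
    = idm (X ⊗ W).
  have := braid_nat (lunit (X := munit)) (idm X).
  rewrite braid_tensl => e; strict e => /(_ W); tidy => e1.
  set b := tl _ _ _ _ in e1 *.
  have [v bv] : exists v, b ∘ v = idm _.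
    exists (tl (ptens (prim X) punit) (ptens punit (prim X)) (braidV munit X) W).
    have e2 := braidVK munit X; strict e2 => /(_ W); tidy; exact.
  by rewrite -[b]comp_idr -bv compA -e1.
by unstrict; exact: b1.
Qed.

Lemma braid_unitr X : braid X munit = lunitV ∘ runit.
Proof.
have b1 W : tl (ptens (prim X) punit) (ptens punit (prim X)) (braid X munit) W
    = idm (X ⊗ W).
  have := braid_nat (idm X) (lunit (X := munit)).
  rewrite braid_tensr => e; strict e => /(_ W); tidy => e1.
  set b := tl _ _ _ _ in e1 *.
  have [v bv] : exists v, b ∘ v = idm _.
    exists (tl (ptens punit (prim X)) (ptens (prim X) punit) (braidV X munit) W).
    have e2 := braidVK X munit; strict e2 => /(_ W); tidy; exact.
  by rewrite -[b]comp_idr -bv compA -e1.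
by unstrict; exact: b1.
Qed.

(** In these names, l or r tells whether [f] sits in the first or second argument of the braiding;
    the digits give its arities. *)
Lemma braidl_nat01 X T (f : Mor munit X) W :
  t22 (braid X T) W ∘ t01 f (T ⊗ W) = T ◁ t01 f W.
Proof.
have := braid_nat f (idm T); rewrite braid_unitl => e.
by strict e => /(_ W); tidy.
Qed.

Lemma braidl_nat10 X T (f : Mor X munit) W :
  (T ◁ t10 f W) ∘ t22 (braid X T) W = t10 f (T ⊗ W).
Proof.
have := esym (braid_nat f (idm T)); rewrite braid_unitl => e.
by strict e => /(_ W); tidy.
Qed.

Lemma braidr_nat11 X Y T (f : Mor X Y) W :
  t22 (braid T Y) W ∘ (T ◁ t11 f W) = t11 f (T ⊗ W) ∘ t22 (braid T X) W.
Proof. by have e := braid_nat (idm T) f; strict e => /(_ W); tidy. Qed.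

Lemma braidl_nat12 X Y Z T (f : Mor X (Y ⊗ Z)) W :
  t22 (braid Y T) (Z ⊗ W) ∘ ((Y ◁ t22 (braid Z T) W) ∘ t12 f (T ⊗ W))
  = (T ◁ t12 f W) ∘ t22 (braid X T) W.
Proof.
have := braid_nat f (idm T); rewrite braid_tensl => e.
by strict e => /(_ W); tidy; rewrite -?compA.
Qed.

Lemma braidr_nat12 X Y Z T (f : Mor X (Y ⊗ Z)) W :
  (Y ◁ t22 (braid T Z) W) ∘ (t22 (braid T Y) (Z ⊗ W) ∘ (T ◁ t12 f W))
  = t12 f (T ⊗ W) ∘ t22 (braid T X) W.
Proof.
have := braid_nat (idm T) f; rewrite braid_tensr => e.
by strict e => /(_ W); tidy; rewrite -?compA.
Qed.

Lemma braidl_nat21 X Y Z T (f : Mor (X ⊗ Y) Z) W :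
  t22 (braid Z T) W ∘ t21 f (T ⊗ W)
  = (T ◁ t21 f W) ∘ (t22 (braid X T) (Y ⊗ W) ∘ (X ◁ t22 (braid Y T) W)).
Proof.
have := braid_nat f (idm T); rewrite braid_tensl => e.
by strict e => /(_ W); tidy; rewrite -?compA.
Qed.

End Braiding.

Arguments braidl_nat01 {C X T} f W.
Arguments braidl_nat10 {C X T} f W.
Arguments braidr_nat11 {C X Y T} f W.
Arguments braidl_nat12 {C X Y Z T} f W.
Arguments braidr_nat12 {C X Y Z T} f W.
Arguments braidl_nat21 {C X Y Z T} f W.

Section AlgebraTail.
Variables (C : monoidalCat) (A : algebra C).
Implicit Types W : C.

Lemma mulA_tail W :
  t21 (mul A) W ∘ t21 (mul A) (A ⊗ W) = t21 (mul A) W ∘ (A ◁ t21 (mul A) W).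
Proof.
by have e := mulA A; rewrite /associative_mul in e; strict e => /(_ W); tidy.
Qed.

Lemma mul_unitl_tail W :
  t21 (mul A) W ∘ t01 (unit_ A) (A ⊗ W) = idm (A ⊗ W).
Proof. by have e := mul_unitl A; strict e => /(_ W); tidy. Qed.

Lemma mul_unitr_tail W :
  t21 (mul A) W ∘ (A ◁ t01 (unit_ A) W) = idm (A ⊗ W).
Proof. by have e := mul_unitr A; strict e => /(_ W); tidy. Qed.
End AlgebraTail.

(** * Coactions of a bialgebra *)

Section Coaction.
Variables (C : braidedCat) (H : bialgebra C).
Implicit Types M N K : C.

(** The diagonal coaction, m ⊗ n ↦ m₀ ⊗ n₀ ⊗ m₁n₁ for modules. *)
Definition tens_coact M N (r : Mor M (M ⊗ H)) (s : Mor N (N ⊗ H)) :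
    Mor (M ⊗ N) ((M ⊗ N) ⊗ H) :=
  ((M ⊗ N) ◁ mul H) ∘ mid M H (braid H N) ∘ (r ⊠ s).

Definition triv_coact M : Mor M (M ⊗ H) := (M ◁ unit_ H) ∘ runitV.

Definition colinear M N (r : Mor M (M ⊗ H)) (s : Mor N (N ⊗ H)) (f : Mor M N) :=
  s ∘ f = (f ▷ H) ∘ r.

Lemma colinear_id M (r : Mor M (M ⊗ H)) : colinear r r (idm M).
Proof. by rewrite /colinear tensm_id comp_idl comp_idr. Qed.

Lemma colinear_comp M N K r s t (g : Mor N K) (f : Mor M N) :
  colinear r s f -> colinear s t g -> colinear r t (g ∘ f).
Proof.
by move=> hf hg; rewrite /colinear compA hg -compA hf compA whiskerr_comp.
Qed.

Lemma colinear_inv M N r s (f : Mor M N) (g : Mor N M) :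
  f ∘ g = idm _ -> g ∘ f = idm _ -> colinear r s f -> colinear s r g.
Proof.
move=> fg gf hf; apply: (epi_iso fg).
rewrite -!compA hf gf comp_idr compA -whiskerr_comp gf tensm_id.
by rewrite comp_idl.
Qed.

Lemma colinear_triv M N (f : Mor M N) :
  colinear (triv_coact M) (triv_coact N) f.
Proof.
rewrite /colinear /triv_coact; unstrict.
by rewrite t11_nat.
Qed.

Lemma colinear_tens M N M' N' r s r' s' (f : Mor M M') (g : Mor N N') :
  colinear r r' f -> colinear s s' g ->
  colinear (tens_coact r s) (tens_coact r' s') (f ⊠ g).
Proof.
move=> hf hg; rewrite /colinear /tens_coact -!compA -tensm_comp hf hg.
rewrite tensm_comp !compA; congr comp; rewrite /mid.
unstrict_tail.
rewrite (tailed (whisker2 (t11_nat g _))); rassoc.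
rewrite (tailed (t11_nat f _)); rassoc.
rewrite [in RHS](tailed (t11_nat f _)); rassoc.
rewrite (tailed (whisker2 (braidr_nat11 _ _))); rassoc.
by do 2![rewrite [in RHS](tailed (t11_nat f _)); rassoc].
Qed.

(** The three H-legs get multiplied in two ways. The product of two legs slides through the
    braiding, and associativity of [mul H] does the rest. *)
Lemma colinear_assoc M N K (r : Mor M (M ⊗ H)) (s : Mor N (N ⊗ H))
    (t : Mor K (K ⊗ H)) :
  colinear (tens_coact (tens_coact r s) t) (tens_coact r (tens_coact s t)) assoc.
Proof.
rewrite /colinear /tens_coact /mid braid_tensr; unstrict_tail.
rewrite (tailed (whisker2 (whisker2 (braidl_nat21 _ _)))); rassoc.
rewrite (tailed (whisker2 (whisker2 (whisker2 (mulA_tail H _))))); rassoc.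
do 2![rewrite (tailed (t12_nat r _)); rassoc].
rewrite (tailed (whisker2 (t22_nat (braid H N) _))); rassoc.
rewrite (tailed (whisker2 (t22_nat (braid H N) _))); rassoc.
by rewrite (tailed (whisker2 (whisker2 (t22_nat _ _)))); rassoc.
Qed.

Lemma colinear_assocV M N K (r : Mor M (M ⊗ H)) (s : Mor N (N ⊗ H))
    (t : Mor K (K ⊗ H)) :
  colinear (tens_coact r (tens_coact s t)) (tens_coact (tens_coact r s) t) assocV.
Proof.
apply: colinear_inv (colinear_assoc r s t); [exact: assocVK | exact: assocK].
Qed.

Lemma comul_mul_tail V :
  t12 (comul H) V ∘ t21 (mul H) V
  = t21 (mul H) (H ⊗ V) ∘ ((H ◁ (H ◁ t21 (mul H) V)) ∘
     ((H ◁ t22 (braid H H) (H ⊗ V)) ∘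
        (t12 (comul H) (H ⊗ (H ⊗ V)) ∘ (H ◁ t12 (comul H) V)))).
Proof.
have e := comul_mul H; rewrite /comul2 /mid -/(comul H) in e.
by strict e => /(_ V); tidy; rassoc.
Qed.

Lemma tens_triv M N :
  tens_coact (triv_coact M) (triv_coact N) = triv_coact (M ⊗ N).
Proof.
rewrite /tens_coact /triv_coact /mid; unstrict_tail.
rewrite (tailed (whisker2 (braidl_nat01 _ _))); rassoc.
by rewrite (tailed (whisker2 (whisker2 (mul_unitl_tail H _)))); tidy.
Qed.

Lemma colinear_triv2 M N K (f : Mor (M ⊗ N) K) :
  colinear (tens_coact (triv_coact M) (triv_coact N)) (triv_coact K) f.
Proof. by rewrite tens_triv; exact: colinear_triv. Qed.

Lemma colinear_runitV M (r : Mor M (M ⊗ H)) :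
  colinear r (tens_coact r (triv_coact munit)) runitV.
Proof.
rewrite /colinear /tens_coact /triv_coact /mid braid_unitr; unstrict_tail.
rewrite (tailed (t12_nat _ _)); rassoc.
by rewrite (tailed (whisker2 (mul_unitr_tail H _))); tidy.
Qed.

Definition coassociative M (r : Mor M (M ⊗ H)) :=
  assoc ∘ (r ▷ H) ∘ r = (M ◁ comul H) ∘ r.

Definition counital M (r : Mor M (M ⊗ H)) :=
  runit ∘ (M ◁ counit H) ∘ r = idm M.

Lemma coassociative_tail M (r : Mor M (M ⊗ H)) : coassociative r ->
  forall V, t12 r (H ⊗ V) ∘ t12 r V = (M ◁ t12 (comul H) V) ∘ t12 r V.
Proof. by move=> e V; rewrite /coassociative in e; strict e => /(_ V); tidy. Qed.

Lemma counital_tail M (r : Mor M (M ⊗ H)) : counital r ->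
  forall V, (M ◁ t10 (counit H) V) ∘ t12 r V = idm (M ⊗ V).
Proof. by move=> e V; rewrite /counital in e; strict e => /(_ V); tidy. Qed.

Lemma coassociative_comul : coassociative (comul H).
Proof. exact: comulA. Qed.

Lemma counital_comul : counital (comul H).
Proof. exact: counitr. Qed.

Lemma coassociative_triv M : coassociative (triv_coact M).
Proof.
have e := comul_unit H; rewrite -/(comul H) in e.
have {}e V : t12 (comul H) V ∘ t01 (unit_ H) V
    = t01 (unit_ H) (H ⊗ V) ∘ t01 (unit_ H) V.
  by strict e => /(_ V); tidy.
rewrite /coassociative /triv_coact; unstrict_tail.
by rewrite (tailed (whisker2 (e _))); rassoc.
Qed.

Lemma counital_triv M : counital (triv_coact M).
Proof.
have e := counit_unit H; rewrite -/(counit H) in e.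
have {}e V : t10 (counit H) V ∘ t01 (unit_ H) V = idm V.
  by strict e => /(_ V); tidy.
rewrite /counital /triv_coact; unstrict_tail.
by rewrite (tailed (whisker2 (e _))); tidy.
Qed.

(** The key is [comul_mul]: the coproduct of a product of legs splits into products of legs, after
    which coassociativity applies to each factor. *)
Lemma coassociative_tens M N (r : Mor M (M ⊗ H)) (s : Mor N (N ⊗ H)) :
  coassociative r -> coassociative s -> coassociative (tens_coact r s).
Proof.
move=> /coassociative_tail hr /coassociative_tail hs.
rewrite /coassociative /tens_coact /mid; unstrict_tail.
rewrite [in RHS](tailed (whisker2 (whisker2 (comul_mul_tail _)))); rassoc.
rewrite [in RHS](tailed (whisker2 (esym (t22_nat (braid H N) _)))); rassoc.
rewrite [in RHS](tailed (esym (t12_nat r _))); rassoc.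
rewrite [in RHS](tailed (whisker2 (esym (hs _)))); rassoc.
rewrite [in RHS](tailed (whisker2 (esym (braidl_nat12 (comul H) _)))); rassoc.
rewrite [in RHS](tailed (esym (hr _))); rassoc.
rewrite (tailed (whisker2 (t12_nat s _))); rassoc.
rewrite [in LHS](tailed (t12_nat r _)); rassoc.
rewrite [in LHS](tailed (whisker2 (t22_nat (braid H N) _))); rassoc.
rewrite [in LHS](tailed (whisker2 (esym (braidr_nat12 s _)))); rassoc.
do 2![rewrite [in LHS](tailed (t12_nat r _)); rassoc].
rewrite [in LHS](tailed (esym (t12_nat r (t12 s _)))); rassoc.
by rewrite [in LHS](tailed (whisker2 (t22_nat (braid H N) _))); rassoc.
Qed.

Lemma counital_tens M N (r : Mor M (M ⊗ H)) (s : Mor N (N ⊗ H)) :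
  counital r -> counital s -> counital (tens_coact r s).
Proof.
move=> /counital_tail hr /counital_tail hs.
have e := counit_mul H; rewrite -/(counit H) in e.
have {}e V : t10 (counit H) V ∘ t21 (mul H) V
    = t10 (counit H) V ∘ (H ◁ t10 (counit H) V).
  by strict e => /(_ V); tidy.
rewrite /counital /tens_coact /mid; unstrict_tail.
rewrite (tailed (whisker2 (whisker2 (e _)))); rassoc.
rewrite (tailed (whisker2 (esym (t22_nat (braid H N) _)))); rassoc.
rewrite (tailed (esym (t12_nat r _))); rassoc.
rewrite (tailed (whisker2 (hs _))); tidy; rassoc.
rewrite (tailed (whisker2 (braidl_nat10 _ _))).
by rewrite (tailed (hr _)); tidy.
Qed.

(** Presented as a diagonal coaction, so that [colinear_tens] applies to maps into A ⊗ H;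
    [cofree_coactE] gives its usual form A ⊗ δ. *)
Definition cofree_coact A := tens_coact (triv_coact A) (comul H).

Lemma cofree_coactE A : cofree_coact A = assocV ∘ (A ◁ comul H).
Proof.
rewrite /cofree_coact /tens_coact /triv_coact /mid; unstrict_tail.
rewrite (tailed (whisker2 (braidl_nat01 _ _))); rassoc.
by rewrite (tailed (whisker2 (whisker2 (mul_unitl_tail H _)))); tidy.
Qed.

(** [locked] keeps rewriting with [compA] from taking this composite apart. *)
Definition cofree_counit A : Mor (A ⊗ H) A :=
  locked (runit ∘ (A ◁ counit H)).

(** The existence half of cofreeness: [(f ▷ H) ∘ r] is the colinear lift of [f]. *)
Lemma colinear_cofree M A (r : Mor M (M ⊗ H)) (f : Mor M A) :
  coassociative r -> colinear r (cofree_coact A) ((f ▷ H) ∘ r).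
Proof.
move=> /coassociative_tail hr; rewrite /colinear cofree_coactE; unstrict_tail.
by rewrite (tailed (hr _)) -compA [RHS](tailed (t11_nat _ _)); rassoc.
Qed.

Lemma cofree_counitE M A (r : Mor M (M ⊗ H)) (f : Mor M A) :
  counital r -> cofree_counit A ∘ ((f ▷ H) ∘ r) = f.
Proof.
move=> hr; rewrite /cofree_counit -lock -!compA (compA (A ◁ _)) -tensm_whiskerlr.
by rewrite tensm_whiskerrl -!compA (compA runit) runit_nat -!compA
  [X in _ ∘ X]compA hr comp_idr.
Qed.

(** The uniqueness half: a colinear h equals [((cofree_counit A ∘ h) ▷ H) ∘ r], because A ⊗ ε
    followed by nothing else undoes the cofree coaction on its first two factors. *)
Lemma cofree_inj M A (r : Mor M (M ⊗ H)) (f g : Mor M (A ⊗ H)) :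
  colinear r (cofree_coact A) f -> colinear r (cofree_coact A) g ->
  cofree_counit A ∘ f = cofree_counit A ∘ g -> f = g.
Proof.
have K : (cofree_counit A ▷ H) ∘ cofree_coact A = idm _.
  have e := counitl (bialg_coalg H); rewrite -/(comul H) -/(counit H) in e.
  have {}e V : t10 (counit H) (H ⊗ V) ∘ t12 (comul H) V = idm (H ⊗ V).
    by strict e => /(_ V); tidy.
  rewrite cofree_coactE /cofree_counit -lock; unstrict_tail.
  by rewrite (tailed (whisker2 (e _))); tidy.
have E h : colinear r (cofree_coact A) h ->
    h = ((cofree_counit A ∘ h) ▷ H) ∘ r.
  by move=> hh; rewrite whiskerr_comp -compA -hh compA K comp_idl.
by move=> /E {2}-> /E {2}-> ->.
Qed.
End Coaction.

Ltac colin :=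
  lazymatch goal with
  | |- colinear _ _ (idm _) => exact: colinear_id
  | |- colinear _ _ (comp _ _) => apply: colinear_comp; [colin | colin]
  | |- colinear _ _ assoc => exact: colinear_assoc
  | |- colinear _ _ assocV => exact: colinear_assocV
  | |- colinear _ _ runitV => exact: colinear_runitV
  | |- colinear _ _ (tensm _ _) => apply: colinear_tens; [colin | colin]
  | |- colinear (triv_coact _ _) _ _ => exact: colinear_triv
  | |- colinear (tens_coact (triv_coact _ _) (triv_coact _ _)) _ _ =>
      exact: colinear_triv2
  | |- _ => by eauto
  end.

(** * Twisted partial actions *)

Section TwistedPartialAction.
Variables (C : braidedCat) (H : hopfAlgebra C) (A : algebra C).
Variables (phi : Mor (H ⊗ A) A) (omega : Mor (H ⊗ H) A).

Local Notation psi := (psiHA phi).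
Local Notation sigma := (sigmaHA omega).
Local Notation e := (cofree_counit H A).
Local Notation rHA := (tens_coact (comul H) (triv_coact H A)).
Local Notation rHH := (tens_coact (comul H) (comul H)).

(** The trivial coaction on A contributes a unit of H, which the product of H absorbs. *)
Lemma psiHA_coact : psi = (phi ▷ H) ∘ rHA.
Proof.
rewrite /psiHA -!compA; congr comp.
rewrite /tens_coact /triv_coact /mid; unstrict_tail.
rewrite (tailed (t12_nat (comul H) _)); rassoc.
rewrite (tailed (whisker2 (t22_nat (braid H A) _))); rassoc.
by rewrite (tailed (whisker2 (whisker2 (mul_unitr_tail H _)))); tidy.
Qed.

Lemma sigmaHA_coact : sigma = (omega ▷ H) ∘ rHH.
Proof.
rewrite /sigmaHA /tens_coact /comul2 tensm_whiskerrl.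
by rewrite -!compA.
Qed.

Lemma colinear_psiHA : colinear rHA (cofree_coact H A) psi.
Proof.
rewrite psiHA_coact; apply: colinear_cofree; apply: coassociative_tens.
  exact: coassociative_comul.
exact: coassociative_triv.
Qed.

Lemma colinear_sigmaHA : colinear rHH (cofree_coact H A) sigma.
Proof.
rewrite sigmaHA_coact; apply: colinear_cofree.
apply: coassociative_tens; exact: coassociative_comul.
Qed.

Lemma counit_psiHA : e ∘ psi = phi.
Proof.
rewrite psiHA_coact; apply: cofree_counitE; apply: counital_tens.
  exact: counital_comul.
exact: counital_triv.
Qed.

Lemma counit_sigmaHA : e ∘ sigma = omega.
Proof.
rewrite sigmaHA_coact; apply: cofree_counitE.
apply: counital_tens; exact: counital_comul.
Qed.

Hint Resolve colinear_psiHA colinear_sigmaHA : core.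

(** A ⊗ ε is left A-linear; this moves it inwards until it meets [psi] or [sigma]. *)
Lemma counit_mul X Y (g : Mor Y (A ⊗ H)) (f : Mor X (A ⊗ Y)) :
  e ∘ ((mul A ▷ H) ∘ (assocV ∘ ((A ◁ g) ∘ f))) = mul A ∘ ((A ◁ (e ∘ g)) ∘ f).
Proof.
have K : e ∘ ((mul A ▷ H) ∘ assocV) = mul A ∘ (A ◁ e).
  rewrite /cofree_counit -lock; unstrict_tail.
  by rewrite (tailed (t21_nat _ _)); rassoc.
by rewrite whiskerl_comp !compA -(compA e) K.
Qed.

Hypothesis tpa : twisted_partial_action phi omega.
Hypothesis pcc : partial_cocycle phi omega.

(** Its image under A ⊗ ε is axiom (ii). *)
Lemma psiHA_multiplicative : psi_multiplicative psi.
Proof.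
rewrite /psi_multiplicative; apply: (cofree_inj (r :=
  tens_coact (tens_coact (comul H) (triv_coact H A)) (triv_coact H A)));
  [colin | colin |].
suff : mul A ∘ (A ◁ phi) ∘ assoc ∘ (psi ▷ A) = phi ∘ (H ◁ mul A) ∘ assoc.
  (* Generalizing [psiHA phi] makes it opaque to the rewriting that follows. *)
  move: counit_psiHA; move: (psiHA phi) => p Ep.
  by rewrite -!compA counit_mul Ep => ->; rewrite -Ep -compA.
rewrite (tpa_mul tpa) /psiHA /mid; unstrict_tail.
by rewrite (tailed (t21_nat phi _)); rassoc.
Qed.

(** Its image under A ⊗ ε is axiom (iii). *)
Lemma twistedHA : twisted_condition psi sigma.
Proof.
rewrite /twisted_condition; apply: (cofree_inj (r :=
  tens_coact (tens_coact (comul H) (comul H)) (triv_coact H A)));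
  [colin | colin |].
move: counit_psiHA counit_sigmaHA (tpa_twisted tpa).
move: (psiHA phi) (sigmaHA omega) => p s Ep Es.
by rewrite -!compA !counit_mul Ep Es.
Qed.

Lemma cocycleHA : cocycle_condition psi sigma.
Proof.
rewrite /cocycle_condition; apply: (cofree_inj (r :=
  tens_coact (tens_coact (comul H) (comul H)) (comul H))); [colin | colin |].
move: counit_psiHA counit_sigmaHA pcc; rewrite /partial_cocycle.
move: (psiHA phi) (sigmaHA omega) => p s Ep Es.
by rewrite -!compA !counit_mul Es.
Qed.

(** Its image under A ⊗ ε is axiom (iv). *)
Lemma nabla_sigmaHA : nabla psi ∘ sigma = sigma.
Proof.
apply: (cofree_inj (r := tens_coact (comul H) (comul H)));
  [rewrite /nabla; colin | colin |].
rewrite counit_sigmaHA [RHS](tpa_omega tpa) /nabla.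
move: counit_psiHA; move: (psiHA phi) (sigmaHA omega) => p s Ep.
rewrite -!compA counit_mul Ep; unstrict_tail.
by rewrite [in RHS](tailed (t22_nat s _)); rassoc.
Qed.

End TwistedPartialAction.

(** * Weak crossed products *)

Section WeakCrossedProduct.
Variables (C : braidedCat) (A : algebra C) (V : C).
Variables (psi : Mor (V ⊗ A) (A ⊗ V)) (sigma : Mor (V ⊗ V) (A ⊗ V)).

Hypothesis psiM : psi_multiplicative psi.
Hypothesis tw : twisted_condition psi sigma.
Hypothesis coc : cocycle_condition psi sigma.
Hypothesis nabla_sigma : nabla psi ∘ sigma = sigma.

Lemma psi_multiplicative_tail W :
  t21 (mul A) (V ⊗ W) ∘ ((A ◁ t22 psi W) ∘ t22 psi (A ⊗ W))
  = t22 psi W ∘ (V ◁ t21 (mul A) W).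
Proof.
have e := psiM; rewrite /psi_multiplicative in e.
by strict e => /(_ W); tidy; rassoc.
Qed.

Lemma twisted_tail W :
  t21 (mul A) (V ⊗ W) ∘ ((A ◁ t22 psi W) ∘ t22 sigma (A ⊗ W))
  = t21 (mul A) (V ⊗ W) ∘ ((A ◁ t22 sigma W) ∘ (t22 psi (V ⊗ W) ∘
      (V ◁ t22 psi W))).
Proof.
have e := tw; rewrite /twisted_condition in e.
by strict e => /(_ W); tidy; rassoc.
Qed.

Lemma cocycle_tail W :
  t21 (mul A) (V ⊗ W) ∘ ((A ◁ t22 sigma W) ∘ t22 sigma (V ⊗ W))
  = t21 (mul A) (V ⊗ W) ∘ ((A ◁ t22 sigma W) ∘ (t22 psi (V ⊗ W) ∘
      (V ◁ t22 sigma W))).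
Proof.
have e := coc; rewrite /cocycle_condition in e.
by strict e => /(_ W); tidy; rassoc.
Qed.

Lemma nabla_sigma_tail W :
  t21 (mul A) (V ⊗ W) ∘ ((A ◁ t22 psi W) ∘ (t22 sigma (A ⊗ W) ∘
    (V ◁ (V ◁ t01 (unit_ A) W)))) = t22 sigma W.
Proof.
have e := nabla_sigma; rewrite /nabla in e.
strict e => /(_ W); tidy; rassoc => <-.
by rewrite -(t22_nat sigma); rassoc.
Qed.

(** Multiplicativity of [psi] merges the two inserted units of A into one. *)
Lemma nabla_idempotent : idempotent (nabla psi).
Proof.
rewrite /idempotent /nabla; unstrict_tail.
do 2![rewrite (tailed (esym (t21_nat (mul A) _))); rassoc].
rewrite (tailed (mulA_tail A _)); rassoc.
rewrite (tailed (whisker2 (esym (t22_nat psi _)))); rassoc.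
rewrite (tailed3 (whisker3 (psi_multiplicative_tail _))); rassoc.
by rewrite (tailed (whisker2 (whisker2 (mul_unitr_tail A _)))); tidy.
Qed.

(** [nabla] is left A-linear and the product ends with [sigma], which [nabla] fixes. *)
Lemma nabla_wcp_mul : nabla psi ∘ wcp_mul psi sigma = wcp_mul psi sigma.
Proof.
rewrite /nabla /wcp_mul /mid; unstrict_tail.
do 4![rewrite (tailed (esym (t21_nat (mul A) _))); rassoc].
rewrite (tailed (mulA_tail A _)); rassoc.
rewrite (tailed (esym (t21_nat (mul A) _))); rassoc.
rewrite (tailed (whisker2 (whisker2 (esym (t22_nat sigma _))))); rassoc.
by rewrite (tailed4 (whisker4 (whisker4 (nabla_sigma_tail _)))); rassoc.
Qed.

(** On the left, the twisted condition moves [psi] ahead of [sigma] and the cocycle condition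
    rebrackets the two [sigma]; on the right, [psi] is distributed over products of A. The two sides
    then differ by associativity of A. *)
Lemma wcp_mulA : associative_mul (wcp_mul psi sigma).
Proof.
rewrite /associative_mul /wcp_mul /mid; unstrict_tail.
have mA := mulA_tail A.
do 4![rewrite [in LHS](tailed (esym (t21_nat (mul A) _))); rassoc].
rewrite (tailed (mA (A ⊗ (V ⊗ W)))); rassoc.
rewrite (tailed (esym (t21_nat (mul A) (t21 (mul A) _)))); rassoc.
rewrite (tailed (whisker2 (whisker2 (t21_nat (mul A) (t22 sigma _))))); rassoc.
rewrite (tailed3 (whisker3 (whisker3 (twisted_tail _)))); rassoc.
rewrite (tailed (whisker2 (whisker2 (esym (t21_nat (mul A) (t22 sigma _)))))); rassoc.
rewrite (tailed (mA (V ⊗ W))); rassoc.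
rewrite (tailed (esym (t21_nat (mul A) (t21 (mul A) _)))); rassoc.
rewrite (tailed (whisker2 (whisker2 (mA (V ⊗ W))))); rassoc.
rewrite (tailed3 (whisker3 (whisker3 (whisker3 (cocycle_tail _))))); rassoc.
do 2![rewrite [in RHS](tailed (whisker2 (esym (psi_multiplicative_tail _)))); rassoc].
do 2![rewrite [in RHS](tailed (whisker2 (t22_nat psi _))); rassoc].
rewrite [in RHS](tailed (whisker2 (whisker2 (t22_nat psi _)))); rassoc.
(* From here on, both sides only have their products in A brought to a common bracketing. *)
do 3![rewrite [in RHS](tailed (whisker2 (esym (t21_nat (mul A) _)))); rassoc].
do 2![rewrite [in RHS](tailed (esym (mA _))); rassoc].
do 2![rewrite [in LHS](tailed (t21_nat (mul A) _)); rassoc].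
rewrite [in LHS](tailed (esym (mA _))); rassoc.
rewrite [in LHS](tailed (t21_nat (mul A) _)); rassoc.
by rewrite [in LHS](tailed (esym (mA _))); rassoc.
Qed.

(** The product takes values in the image of [nabla], so the [i ∘ p] between two multiplications
    disappears. *)
Lemma induced_mulA (s : splitting (nabla psi)) :
  associative_mul (induced_mul s (wcp_mul psi sigma)).
Proof.
rewrite /associative_mul /induced_mul.
move: nabla_wcp_mul wcp_mulA; move: (wcp_mul psi sigma) => m nm mA.
case: s => X i p /= ip pi.
have nm' : i ∘ (p ∘ m) = m by rewrite compA ip.
have L : (i ⊠ i) ∘ ((p ∘ m ∘ (i ⊠ i)) ▷ X) = (m ▷ (A ⊗ V)) ∘ ((i ⊠ i) ⊠ i).
  by rewrite -!tensm_comp comp_idr comp_idl -!compA (compA p) (compA i) nm'.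
have R : (i ⊠ i) ∘ (X ◁ (p ∘ m ∘ (i ⊠ i))) = ((A ⊗ V) ◁ m) ∘ (i ⊠ (i ⊠ i)).
  by rewrite -!tensm_comp comp_idr comp_idl -!compA (compA p) (compA i) nm'.
rewrite -(compA (p ∘ m) (i ⊠ i) (_ ▷ X)) L.
rewrite -(compA (p ∘ m) (i ⊠ i) (X ◁ _)) R -!compA -assoc_nat.
by rewrite (compA m) mA -!compA.
Qed.
End WeakCrossedProduct.

(** * The category of modules *)

Section ModuleCategory.
Local Open Scope ring_scope.
Variable k : comPzRingType.
Local Notation C := (mod_braidedCat k).
Implicit Types X Y Z W : C.

Lemma ap_comp X Y Z (g : Mor Y Z) (f : Mor X Y) x : ap (g ∘ f) x = ap g (ap f x).
Proof. by []. Qed.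

Lemma ap_id X (x : elt X) : ap (idm X) x = x.
Proof. by []. Qed.

Lemma ap_tens X Y X' Y' (f : Mor X X') (g : Mor Y Y') x y :
  ap (f ⊠ g) (pure x y) = pure (ap f x) (ap g y).
Proof. exact: tmapE. Qed.

Lemma ap_assoc X Y Z (x : elt X) (y : elt Y) (z : elt Z) :
  ap assoc (pure (pure x y) z) = pure x (pure y z).
Proof. exact: tassocE. Qed.

Lemma ap_assocV X Y Z (x : elt X) (y : elt Y) (z : elt Z) :
  ap assocV (pure x (pure y z)) = pure (pure x y) z.
Proof. exact: tassocVE. Qed.

Lemma ap_braid X Y (x : elt X) (y : elt Y) :
  ap (braid X Y) (pure x y) = pure y x.
Proof. exact: tswapE. Qed.

Lemma ap_sum X Y (f : Mor X Y) I (s : seq I) (F : I -> elt X) :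
  ap f (\sum_(i <- s) F i) = \sum_(i <- s) ap f (F i).
Proof. exact: (GRing.raddf_sum (f : {linear elt X -> elt Y})). Qed.

Definition insl X Y (x : elt X) : Mor Y (X ⊗ Y) := lin_of (@tpurer k X Y x).
Definition insr X Y (y : elt Y) : Mor X (X ⊗ Y) := lin_of (@tpurel k X Y y).

Lemma ap_insl X Y (x : elt X) (y : elt Y) : ap (insl Y x) y = pure x y.
Proof. by []. Qed.

Lemma ap_insr X Y (x : elt X) (y : elt Y) : ap (insr X y) x = pure x y.
Proof. by []. Qed.

Lemma pure_suml X Y I (s : seq I) (F : I -> elt X) (y : elt Y) :
  pure (\sum_(i <- s) F i) y = \sum_(i <- s) pure (F i) y.
Proof. exact: (ap_sum (insr X y)). Qed.

Lemma pure_sumr X Y I (s : seq I) (F : I -> elt Y) (x : elt X) :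
  pure x (\sum_(i <- s) F i) = \sum_(i <- s) pure x (F i).
Proof. exact: (ap_sum (insl Y x)). Qed.

Lemma pure_span X Y (x : elt (X ⊗ Y)) :
  exists s : seq (elt X * elt Y), x = \sum_(z <- s) pure z.1 z.2.
Proof. exact: tensor_span. Qed.

Definition apE :=
  (ap_comp, ap_id, ap_tens, ap_assoc, ap_assocV, ap_braid, ap_insl, ap_insr).

Variables (H : hopfAlgebra C) (A : algebra C).
Variables (phi : Mor (H ⊗ A) A) (omega : Mor (H ⊗ H) A).

Lemma psiHA_pure (h : elt H) (b : elt A) (s : seq (elt H * elt H)) :
  ap (comul H) h = \sum_(x <- s) pure x.1 x.2 ->
  ap (psiHA phi) (pure h b) = \sum_(x <- s) pure (ap phi (pure x.1 b)) x.2.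
Proof.
move=> Eh; pose f := (phi ▷ H) ∘ assocV ∘ (H ◁ braid H A) ∘ assoc.
transitivity (ap f (pure (ap (comul H) h) b)); first by rewrite ap_comp ap_tens.
rewrite Eh pure_suml (ap_sum f); apply: eq_bigr => x _.
by rewrite !apE.
Qed.

Lemma sigmaHA_pure (h l : elt H) (s t : seq (elt H * elt H)) :
  ap (comul H) h = \sum_(x <- s) pure x.1 x.2 ->
  ap (comul H) l = \sum_(y <- t) pure y.1 y.2 ->
  ap (sigmaHA omega) (pure h l)
    = \sum_(x <- s) \sum_(y <- t)
        pure (ap omega (pure x.1 y.1)) (amul x.2 y.2).
Proof.
move=> Eh El; pose f := (omega ⊠ mul H) ∘ mid H H (braid H H).
transitivity (ap f (pure (ap (comul H) h) (ap (comul H) l))).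
  by rewrite !ap_comp ap_tens.
rewrite Eh El pure_suml (ap_sum f); apply: eq_bigr => x _.
rewrite pure_sumr (ap_sum f); apply: eq_bigr => y _.
by rewrite !apE.
Qed.

Lemma muAH_pure (a b : elt A) (h l : elt H)
    (hs : seq (elt H * elt H * elt H)) (ls : seq (elt H * elt H)) :
  ap ((comul H ▷ H) ∘ comul H) h
    = \sum_(x <- hs) pure (pure x.1.1 x.1.2) x.2 ->
  ap (comul H) l = \sum_(y <- ls) pure y.1 y.2 ->
  ap (muAH phi omega) (pure (pure a h) (pure b l))
    = \sum_(x <- hs) \sum_(y <- ls)
        pure (amul (amul a (ap phi (pure x.1.1 b))) (ap omega (pure x.1.2 y.1)))
             (amul x.2 y.2).
Proof.
move=> Eh El.
(* For fixed y, the summand is linear in h₁ ⊗ h₂ ⊗ h₃. It therefore depends only on the iterated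
   coproduct of h, and any expression [hs] of it may be used. *)
pose L (y : elt H * elt H) : Mor ((H ⊗ H) ⊗ H) (A ⊗ H) :=
  (mul A ∘ ((mul A ∘ insl A a ∘ phi ∘ insr H b) ⊠ (omega ∘ insr H y.1)))
    ⊠ (mul H ∘ insr H y.2).
have LE y p q r : ap (L y) (pure (pure p q) r) =
    pure (amul (amul a (ap phi (pure p b))) (ap omega (pure q y.1))) (amul r y.2).
  by rewrite !apE.
transitivity (\sum_(y <- ls) ap (L y) (ap ((comul H ▷ H) ∘ comul H) h)).
  (* [psi] splits h and [sigma] then splits the second leg, so the coproduct is iterated on the
     right; coassociativity matches it with the given form. *)
  have -> : (comul H ▷ H) ∘ comul H = assocV ∘ (H ◁ comul H) ∘ comul H.
    by rewrite -compA -comulA !compA assocK comp_idl.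
  have [s Es] := pure_span (ap (comul H) h).
  pose f := (mul A ▷ H) ∘ assocV ∘ (mul A ⊠ sigmaHA omega)
    ∘ assocV ∘ (A ◁ assoc).
  transitivity (ap f (pure a (pure (ap (psiHA phi) (pure h b)) l))).
    by rewrite /muAH /mid !apE.
  rewrite (psiHA_pure b Es) pure_suml pure_sumr (ap_sum f).
  transitivity (\sum_(z <- s) \sum_(y <- ls)
      ap (L y ∘ assocV) (pure z.1 (ap (comul H) z.2))).
    apply: eq_bigr => z _; have [t Et] := pure_span (ap (comul H) z.2).
    rewrite Et pure_sumr.
    pose g := (mul A ▷ H) ∘ assocV.
    transitivity (ap g (pure (amul a (ap phi (pure z.1 b)))
      (ap (sigmaHA omega) (pure z.2 l)))); first by rewrite !apE.
    rewrite (sigmaHA_pure Et El) pure_sumr (ap_sum g).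
    transitivity (\sum_(x <- t) \sum_(y <- ls)
        ap (L y ∘ assocV) (pure z.1 (pure x.1 x.2))).
      apply: eq_bigr => x _; rewrite pure_sumr (ap_sum g).
      by apply: eq_bigr => y _; rewrite ap_comp ap_assocV LE /g !apE.
    etransitivity; first exact: exchange_big.
    by apply: eq_bigr => y _; rewrite (ap_sum (L y ∘ assocV)).
  etransitivity; first exact: exchange_big.
  apply: eq_bigr => y _; rewrite ap_comp Es.
  rewrite (ap_sum (assocV ∘ (H ◁ comul H))) (ap_sum (L y)).
  by apply: eq_bigr => z _; rewrite !ap_comp ap_tens.
rewrite Eh; etransitivity; last exact: exchange_big.
apply: eq_bigr => y _; rewrite (ap_sum (L y)).
by apply: eq_bigr => x _; rewrite LE.
Qed.
End ModuleCategory.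

Local Open Scope ring_scope.
Local Open Scope cat_scope.

Theorem mainTheorem1 :
  (forall (C : braidedCat), idempotents_split C ->
   forall (H : hopfAlgebra C) (A : algebra C)
     (phi : Mor (H ⊗ A) A) (omega : Mor (H ⊗ H) A),
   twisted_partial_action phi omega ->
   partial_cocycle phi omega ->
   [/\ weak_crossed_product (psiHA phi) (sigmaHA omega) (muAH phi omega),
       inhabited (splitting (nabla (psiHA phi)))
     & forall s : splitting (nabla (psiHA phi)),
         associative_mul (induced_mul s (muAH phi omega))])
  /\
  (forall (k : comPzRingType) (H : hopfAlgebra (mod_braidedCat k))
     (A : algebra (mod_braidedCat k))
     (phi : Mor (H ⊗ A) A) (omega : Mor (H ⊗ H) A),
   twisted_partial_action phi omega ->
   partial_cocycle phi omega ->
   forall (a b : elt A) (h l : elt H)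
     (* Sweedler notation: any expressions of the iterated coproduct of h as
        a sum of h_(1) ⊗ h_(2) ⊗ h_(3) and of the coproduct of l as a sum
        of l_(1) ⊗ l_(2). *)
     (hs : seq (elt H * elt H * elt H)) (ls : seq (elt H * elt H)),
   ap ((comul H ▷ H) ∘ comul H) h
     = \sum_(x <- hs) pure (pure x.1.1 x.1.2) x.2 ->
   ap (comul H) l = \sum_(y <- ls) pure y.1 y.2 ->
   ap (muAH phi omega) (pure (pure a h) (pure b l))
     = \sum_(x <- hs) \sum_(y <- ls)
         pure (amul (amul a (ap phi (pure x.1.1 b))) (ap omega (pure x.1.2 y.1)))
              (amul x.2 y.2)).
Proof.
split=> [C splitC H A phi omega tpa pcc | k H A phi omega _ _ a b h l hs ls].
  have psiM := psiHA_multiplicative tpa; have tw := twistedHA tpa.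
  have coc := cocycleHA pcc; have ns := nabla_sigmaHA tpa.
  have ni := nabla_idempotent psiM.
  split; [by split | exact: splitC | move=> s].
  exact: induced_mulA.
exact: muAH_pure.
Qed.
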